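(* Let $\gamma$ be the boundary of a convex billiard table with $C^2$ boundary. If $\gamma$ contains its evolute $\beta$ (that is, the evolute is contained within the billiard boundary), then the mountain pass 2-periodic trajectory of the billiard is linearly stable.
   Context: Billiard setting. $\gamma:S^1\to\mathbb R^2$ is a positively oriented, unit-speed parametrized simple closed $C^2$ curve bounding the convex table. The evolute $\beta$ of $\gamma$ is the locus of its centers of curvature, or equivalently the envelope of the family of lines normal to $\gamma$. Put $\ell(u,v)=|\gamma(u)-\gamma(v)|$ and $S=-\ell$. 2-periodic trajectories. Let $\mathcal C^2_\Delta=\{(x^1,x^2,x^3)\in (S^1)^3: x^3=x^1,\ x^1\neq x^2\}$ and $L(x)=S(x^1,x^2)+S(x^2,x^3)=-2\ell(x^1,x^2)$ on it; 2-periodic trajectories are the critical points of $L$ on $\mathcal C^2_\Delta$ (each such is a chord perpendicular to $\gamma$ at both ends). Let $(a,b,a)$ be a minimizer of $L$ on $\mathcal C^2_\Delta$; then $(b,a,b)$ is another minimizer, a re-indexing of the same trajectory. The mountain pass 2-periodic trajectory is the critical point $x$ of $L$ produced by the mountain pass theorem applied between $(a,b,a)$ and $(b,a,b)$: its critical value is $L(x)=\inf_{\sigma}\max_{s\in[0,1]}L(\sigma(s))$, the infimum over $C^1$ paths $\sigma:[0,1]\to\mathcal C^2_\Delta$ from $(a,b,a)$ to $(b,a,b)$. Stability. The billiard map $T:(x^i,y^i)\mapsto(x^{i+1},y^{i+1})$, with $y^i=-\cos\phi^i$ ($\phi^i\in(0,\pi)$ the angle between $\dot\gamma(x^i)$ and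 the outgoing segment), sends a reflection point and angle to the next one. A 2-periodic trajectory is linearly stable if every eigenvalue of $dT^2$ at $(x^1,y^1)$ has modulus less than or equal to $1$. *)

(* Defs.v *)
From mathcomp Require Import all_boot all_order all_algebra.
From mathcomp Require Import complex.
From mathcomp Require Import all_classical all_reals all_analysis.

Set Implicit Arguments.
Unset Strict Implicit.
Unset Printing Implicit Defensive.

Import Order.TTheory GRing.Theory Num.Theory.
Import numFieldNormedType.Exports.

Local Open Scope ring_scope.
Local Open Scope classical_set_scope.

(* The library norm on 'rV[R]_2 is the sup norm; it is used only for the
   topology and for differentiability. Lengths and angles are Euclidean. *)
Definition dot (R : realType) (u v : 'rV[R]_2) : R := (u *m v^T) 0 0.

Definition enorm (R : realType) (u : 'rV[R]_2) : R := Num.sqrt (dot u u).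

Definition angle (R : realType) (u v : 'rV[R]_2) : R :=
  acos (dot u v / (enorm u * enorm v)).

(* Rotation by +pi/2. *)
Definition rot90 (R : realType) (u : 'rV[R]_2) : 'rV[R]_2 :=
  \row_(j < 2) [:: - u 0 1; u 0 0]`_j.

Definition C1 (R : realType) (V : normedModType R) (f : R -> V) : Prop :=
  (forall t, derivable f t 1) /\ continuous (derive1 f).

(* The circle S^1 is R / PZ: its points are represented by real numbers, and
   functions on it by P-periodic functions on R. *)
Definition same_pt (R : realType) (P u v : R) : Prop :=
  exists k : int, u - v = k%:~R * P.

Record simple_closed_C2_curve (R : realType) (P : R) (gamma : R -> 'rV[R]_2)
    : Prop := {
  curve_period_gt0 : 0 < P ;
  curve_periodic : forall t, gamma (t + P) = gamma t ;
  curve_simple : forall s t, gamma s = gamma t -> same_pt P s t ;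
  curve_C1 : C1 gamma ;
  curve_C2 : C1 (derive1 gamma) ;
  curve_unit_speed : forall t, enorm (derive1 gamma t) = 1 }.

(* gamma is positively oriented when the interior of K lies on its left. *)
Record bounds_convex_table (R : realType) (P : R) (gamma : R -> 'rV[R]_2)
    (K : set 'rV[R]_2) : Prop := {
  table_curve : simple_closed_C2_curve P gamma ;
  table_convex : convex_set K ;
  table_compact : compact K ;
  table_boundary : closure K `\` K° = range gamma ;
  table_positively_oriented : forall t,
    \forall e \near 0^'+, K° (gamma t + e *: rot90 (derive1 gamma t)) }.

(* Signed curvature: gamma'' = curvature *: rot90 gamma' at unit speed. *)
Definition curvature (R : realType) (gamma : R -> 'rV[R]_2) (t : R) : R :=
  dot (derive1 (derive1 gamma) t) (rot90 (derive1 gamma t)).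

(* A point of zero curvature has its centre of curvature at infinity. *)
Definition evolute (R : realType) (gamma : R -> 'rV[R]_2) : set 'rV[R]_2 :=
  [set gamma t + (curvature gamma t)^-1 *: rot90 (derive1 gamma t)
    | t in [set t | curvature gamma t != 0]].

Definition ell (R : realType) (gamma : R -> 'rV[R]_2) (u v : R) : R :=
  enorm (gamma u - gamma v).

Definition S_fun (R : realType) (gamma : R -> 'rV[R]_2) (u v : R) : R :=
  - ell gamma u v.

Definition triple (R : realType) (x1 x2 x3 : R) : 'rV[R]_3 :=
  \row_(j < 3) [:: x1; x2; x3]`_j.

Definition C2Delta (R : realType) (P : R) : set 'rV[R]_3 :=
  [set x | same_pt P (x 0 ord_max) (x 0 0) /\ ~ same_pt P (x 0 0) (x 0 1)].

Definition L_fun (R : realType) (gamma : R -> 'rV[R]_2) (x : 'rV[R]_3) : R :=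
  S_fun gamma (x 0 0) (x 0 1) + S_fun gamma (x 0 1) (x 0 ord_max).

(* The tangent space of the surface C2Delta is {v | v^3 = v^1}. *)
Definition critical_point (R : realType) (P : R) (gamma : R -> 'rV[R]_2)
    (x : 'rV[R]_3) : Prop :=
  C2Delta P x /\
  forall v : 'rV[R]_3, v 0 ord_max = v 0 0 -> is_derive x v (L_fun gamma) 0.

Definition minimizer (R : realType) (P : R) (gamma : R -> 'rV[R]_2)
    (x : 'rV[R]_3) : Prop :=
  C2Delta P x /\ forall z, C2Delta P z -> L_fun gamma x <= L_fun gamma z.

(* A C^1 path [0,1] -> (S^1)^3 lifts to a C^1 path in R^3, which extends to a
   C^1 function on R; only its values on [0,1] matter. *)
Record pass_path (R : realType) (P a b : R) (sigma : R -> 'rV[R]_3) : Prop := {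
  pass_C1 : C1 sigma ;
  pass_C2Delta : forall s : R, s \in `[0, 1] -> C2Delta P (sigma s) ;
  pass_start : forall j, same_pt P (sigma 0 0 j) (triple a b a 0 j) ;
  pass_end : forall j, same_pt P (sigma 1 0 j) (triple b a b 0 j) }.

Definition mountain_pass_value (R : realType) (P : R) (gamma : R -> 'rV[R]_2)
    (a b : R) : R :=
  inf [set sup [set L_fun gamma (sigma s) | s in `[0, 1]]
        | sigma in pass_path P a b].

Definition mountain_pass_trajectory (R : realType) (P : R)
    (gamma : R -> 'rV[R]_2) (a b : R) (x : 'rV[R]_3) : Prop :=
  critical_point P gamma x /\ L_fun gamma x = mountain_pass_value P gamma a b.

Definition phase_pt (R : realType) (x y : R) : 'rV[R]_2 :=
  \row_(j < 2) [:: x; y]`_j.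

(* z = (x, y) and w = (x', y') with y = - cos phi, y' = - cos phi'. By the
   reflection law phi', the angle between gamma'(x') and the segment leaving
   x', is also the angle between gamma'(x') and the segment arriving from x. *)
Definition billiard_step (R : realType) (P : R) (gamma : R -> 'rV[R]_2)
    (z w : 'rV[R]_2) : Prop :=
  let x := z 0 0 in let x' := w 0 0 in
  let phi := angle (derive1 gamma x) (gamma x' - gamma x) in
  let phi' := angle (derive1 gamma x') (gamma x' - gamma x) in
  [/\ x < x' < x + P, 0 < phi < pi, z 0 1 = - cos phi & w 0 1 = - cos phi'].

(* The billiard map, lifted from S^1 x (-1,1) to R x (-1,1) by choosing the
   representative of the next reflection point in (x, x + P). *)
Definition billiard_map (R : realType) (P : R) (gamma : R -> 'rV[R]_2)
    (z : 'rV[R]_2) : 'rV[R]_2 :=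
  get [set w | billiard_step P gamma z w].

(* The lift maps x^1 to x^1 + P after two bounces; since it commutes with
   translation by P, its differential there is that of T^2 on the quotient. *)
Definition linearly_stable (R : realType) (P : R) (gamma : R -> 'rV[R]_2)
    (x : 'rV[R]_3) : Prop :=
  let T2 := billiard_map P gamma \o billiard_map P gamma in
  let y1 := - cos (angle (derive1 gamma (x 0 0)) (gamma (x 0 1) - gamma (x 0 0))) in
  let z := phase_pt (x 0 0) y1 in
  differentiable T2 z /\
  forall lambda : R[i],
    eigenvalue (map_mx (real_complex R) (jacobian T2 z)) lambda ->
    `|lambda| <= 1.

(* Main.v *)
(* A double normal at the mountain pass level is not a strict local maximum of
   the length. Since the evolute is bounded, the curvature k of the closed curve
   is positive, and since the centre of curvature at an end of a double normal
   (u, v) of length l lies in the table, i.e. before the other end,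
   A = l k(u) - 1 and B = l k(v) - 1 are nonnegative. The differential of T^2 has
   determinant 1 and trace 4 A B - 2, so it remains to see that A B <= 1. If
   A B > 1, then l exceeds the sum of the radii of curvature and the width of the
   table is smaller than l in some direction n close to that of the chord. Along
   a path from (a, b) to (b, a) the chord must become parallel to n, where its
   length is at most that width; hence the mountain pass value lies strictly
   above -2 l. *)

Require Import Defs.
From mathcomp Require Import all_boot all_order all_algebra.
From mathcomp Require Import complex.
From mathcomp Require Import all_classical all_reals all_analysis.
From mathcomp Require Import zify ring lra.

Set Implicit Arguments.
Unset Strict Implicit.
Unset Printing Implicit Defensive.

Import Order.TTheory GRing.Theory Num.Theory.
Import numFieldNormedType.Exports.

Local Open Scope ring_scope.
Local Open Scope classical_set_scope.

(** * Plane vectors and calculus *)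

(** The trace [4 A B - 2] lies in [-2, 2] exactly when [0 <= A B <= 1]: the evolute gives the lower
    bound, the pass level the upper one. As [A B - 1 = l (l k(u) k(v) - k(u) - k(v))], the upper
    bound is carried around without division, as [l * (k u * k v) <= k u + k v]. The direction [n]
    has to be tilted: along the chord itself the tangents at its two ends are support lines, so the
    width there is exactly [l]. Disks slightly larger than the osculating ones bound the curve near
    both ends; they make the comparison affine in the cosine between [n] and the chord, and strict
    as soon as this cosine is below 1. The billiard map is a choice from a relation. Before it can
    be differentiated, the next bounce must be shown to exist, to be unique and to depend
    continuously on the data near a double normal; uniqueness is where strict convexity, and through
    it positive curvature, enters. *)

Section Plane.
Context {R : realType}.
Implicit Types u v w : 'rV[R]_2.

Lemma dotE u v : dot u v = u 0 0 * v 0 0 + u 0 1 * v 0 1.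
Proof.
rewrite /dot mxE big_ord_recl big_ord1 !mxE.
by congr (_ + u 0 _ * v 0 _); apply: val_inj.
Qed.

Lemma rot90_0 u : rot90 u 0 0 = - u 0 1. Proof. by rewrite mxE. Qed.
Lemma rot90_1 u : rot90 u 0 1 = u 0 0. Proof. by rewrite mxE. Qed.

Lemma rV2P u v : u 0 0 = v 0 0 -> u 0 1 = v 0 1 -> u = v.
Proof.
move=> u0 u1; apply/rowP => i.
by case: i => -[|[|//]] ?; [move: u0 | move: u1]; congr (_ = _);
  congr (_ 0 _); apply: val_inj.
Qed.

Definition coordE := (dotE, rot90_0, rot90_1, mxE).

Lemma dotC u v : dot u v = dot v u.
Proof. by rewrite !dotE; ring. Qed.

Lemma dotDl u v w : dot (u + v) w = dot u w + dot v w.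
Proof. by rewrite /dot mulmxDl mxE. Qed.

Lemma dotNl u w : dot (- u) w = - dot u w.
Proof. by rewrite /dot mulNmx mxE. Qed.

Lemma dotBl u v w : dot (u - v) w = dot u w - dot v w.
Proof. by rewrite dotDl dotNl. Qed.

Lemma dotZl (a : R) u w : dot (a *: u) w = a * dot u w.
Proof. by rewrite /dot -scalemxAl mxE. Qed.

Lemma dotDr u v w : dot w (u + v) = dot w u + dot w v.
Proof. by rewrite !(dotC w) dotDl. Qed.

Lemma dotNr u w : dot w (- u) = - dot w u.
Proof. by rewrite !(dotC w) dotNl. Qed.

Lemma dotBr u v w : dot w (u - v) = dot w u - dot w v.
Proof. by rewrite !(dotC w) dotBl. Qed.

Lemma dotZr (a : R) u w : dot w (a *: u) = a * dot w u.
Proof. by rewrite !(dotC w) dotZl. Qed.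

Lemma dot0l w : dot 0 w = 0.
Proof. by rewrite -(scale0r 0) dotZl mul0r. Qed.

Lemma dot_rot90 u v : dot (rot90 u) (rot90 v) = dot u v.
Proof. by rewrite !coordE; ring. Qed.

Lemma dot_rot90_self u : dot u (rot90 u) = 0.
Proof. by rewrite !coordE; ring. Qed.

Lemma rot90N u : rot90 (- u) = - rot90 u.
Proof. by apply: rV2P; rewrite !coordE. Qed.

Lemma rot90_rot90 u : rot90 (rot90 u) = - u.
Proof. by apply: rV2P; rewrite !coordE. Qed.

Definition dotl := (dotDl, dotDr, dotNl, dotNr, dotZl, dotZr, dot0l).

Lemma dot_eq0 u : dot u u = 0 -> u = 0.
Proof.
by rewrite dotE => u0; apply: rV2P; rewrite mxE; apply/eqP;
  rewrite -sqrf_eq0; apply/eqP; nra.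
Qed.

Lemma lagrange_identity u v :
  dot u v ^+ 2 + dot u (rot90 v) ^+ 2 = dot u u * dot v v.
Proof. by rewrite !coordE; ring. Qed.

Lemma cauchy_schwarz u v : dot u v ^+ 2 <= dot u u * dot v v.
Proof. by rewrite -lagrange_identity lerDl sqr_ge0. Qed.

Lemma enorm_sqr u : enorm u ^+ 2 = dot u u.
Proof. by rewrite /enorm sqr_sqrtr// dotE; nra. Qed.

Lemma enorm_ge0 u : 0 <= enorm u.
Proof. exact: sqrtr_ge0. Qed.

Lemma enormN u : enorm (- u) = enorm u.
Proof. by rewrite /enorm dotNl dotNr opprK. Qed.

Lemma enorm_eq0 u : enorm u = 0 -> u = 0.
Proof. by move=> u0; apply: dot_eq0; rewrite -enorm_sqr u0 expr0n. Qed.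

Lemma dot_unit u v : dot v v = 1 ->
  u = dot u v *: v + dot u (rot90 v) *: rot90 v.
Proof.
rewrite dotE => v1; apply: rV2P; rewrite !coordE.
  by rewrite -[LHS]mulr1 -v1; ring.
by rewrite -[LHS]mulr1 -v1; ring.
Qed.

End Plane.

(** * Derivatives, limits and difference quotients of plane curves *)

Section Derivatives.
Context {R : realType}.

Lemma is_derive_mx m n (f : R -> 'M[R]_(m, n)) (t : R) (df : 'M[R]_(m, n)) :
  is_derive t 1 f df <-> forall i j, is_derive t 1 (fun s => f s i j) (df i j).
Proof.
split=> [[fd fdf] i j|fd].
  split; first exact: ((derivable_mxP _ _ _).1 fd).
  by rewrite -fdf derive_mx// mxE.
have fd' : derivable f t 1 by apply/derivable_mxP => i j; case: (fd i j).
split=> //; rewrite derive_mx//; apply/matrixP => i j.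
by rewrite mxE; case: (fd i j).
Qed.

Lemma is_derive_dot (f g : R -> 'rV[R]_2) (t : R) df dg :
  is_derive t 1 f df -> is_derive t 1 g dg ->
  is_derive t 1 (fun s => dot (f s) (g s)) (dot df (g t) + dot (f t) dg).
Proof.
move=> /is_derive_mx fd /is_derive_mx gd.
under eq_fun do rewrite dotE.
have -> : dot df (g t) + dot (f t) dg =
    (f t 0 0 * dg 0 0 + g t 0 0 * df 0 0) + (f t 0 1 * dg 0 1 + g t 0 1 * df 0 1).
  by rewrite !dotE; ring.
by apply: is_deriveD; exact: is_deriveM.
Qed.

Lemma is_derive_rot90 (f : R -> 'rV[R]_2) (t : R) df :
  is_derive t 1 f df -> is_derive t 1 (fun s => rot90 (f s)) (rot90 df).
Proof.
move=> /is_derive_mx fd; apply/is_derive_mx => i j.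
under eq_fun do rewrite mxE; rewrite mxE.
by case: j => -[|[|//]] ? /=; [apply: is_deriveN|].
Qed.

Lemma derive1_periodic (V : normedModType R) (f : R -> V) (c : R) :
  (forall t, f (t + c) = f t) -> forall t, derive1 f (t + c) = derive1 f t.
Proof.
move=> fc t; rewrite !derive1E /derive.
by under eq_fun do rewrite /= addrA !fc.
Qed.

Lemma cvg_rV2 (T : Type) (F : set_system T) {FF : Filter F}
    (f : T -> 'rV[R]_2) (l : 'rV[R]_2) :
  f x 0 0 @[x --> F] --> l 0 0 -> f x 0 1 @[x --> F] --> l 0 1 ->
  f x @[x --> F] --> l.
Proof.
move=> f0 f1; apply/cvgrPdist_le => /= e e0.
move/cvgrPdist_le : f0 => /(_ _ e0) f0; move/cvgrPdist_le : f1 => /(_ _ e0) f1.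
near=> x.
rewrite /Num.Def.normr/= mx_normrE (bigmax_le _ (ltW e0))//= => -[i j] _ /=.
rewrite ord1 !mxE; case: j => -[|[|//]] j /=.
  by rewrite (_ : Ordinal j = 0); [near: x | exact: val_inj].
by rewrite (_ : Ordinal j = 1); [near: x | exact: val_inj].
Unshelve. all: by end_near. Qed.

Lemma cvg_coord (T : Type) (F : set_system T) {FF : Filter F} m n
    (f : T -> 'M[R]_(m, n)) (l : 'M[R]_(m, n)) i j :
  f x @[x --> F] --> l -> f x i j @[x --> F] --> l i j.
Proof.
move=> fl.
apply: (@cvg_comp _ _ _ f (fun M : 'M[R]_(m, n) => M i j) _ _ _ fl).
exact: coord_continuous.
Qed.

Lemma cvg_dot (T : Type) (F : set_system T) {FF : Filter F}
    (f g : T -> 'rV[R]_2) (u v : 'rV[R]_2) :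
  f x @[x --> F] --> u -> g x @[x --> F] --> v ->
  dot (f x) (g x) @[x --> F] --> dot u v.
Proof.
move=> fu gv; under eq_fun do rewrite dotE; rewrite dotE.
by apply: cvgD; apply: cvgM; exact: cvg_coord.
Qed.

Lemma cvg_rot90 (T : Type) (F : set_system T) {FF : Filter F}
    (f : T -> 'rV[R]_2) (u : 'rV[R]_2) :
  f x @[x --> F] --> u -> rot90 (f x) @[x --> F] --> rot90 u.
Proof.
move=> fu; apply: cvg_rV2.
  under eq_fun do rewrite rot90_0; rewrite rot90_0.
  by apply: cvgN; exact: cvg_coord.
by under eq_fun do rewrite rot90_1; rewrite rot90_1; exact: cvg_coord.
Qed.

Lemma cvg_enorm (T : Type) (F : set_system T) {FF : Filter F}
    (f : T -> 'rV[R]_2) (u : 'rV[R]_2) :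
  f x @[x --> F] --> u -> enorm (f x) @[x --> F] --> enorm u.
Proof.
move=> fu; apply: (@cvg_comp _ _ _ (fun x => dot (f x) (f x)) Num.sqrt _ (nbhs (dot u u))).
  by apply: cvg_dot; exact: fu.
exact: sqrt_continuous.
Qed.

(** Carathéodory's difference quotient: the value at [s = t] makes [slopeE] hold without exception
    and [slope f t] continuous at [t]. *)
Definition slope (V : normedModType R) (f : R -> V) (t s : R) : V :=
  if s == t then derive1 f t else (s - t)^-1 *: (f s - f t).

Lemma slopeE (V : normedModType R) (f : R -> V) t s :
  f s = f t + (s - t) *: slope f t s.
Proof.
rewrite /slope; case: eqVneq => [->|st]; first by rewrite subrr scale0r addr0.
by rewrite scalerA mulfV ?subr_eq0// scale1r addrC subrK.
Qed.

Lemma cvg_slope (V : normedModType R) (f : R -> V) (t : R) d :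
  is_derive t 1 f d -> slope f t s @[s --> t] --> d.
Proof.
move=> [fd fdE].
have H : (fun h => h^-1 *: ((f \o shift t) (h *: 1) - f t)) @ 0^' --> d.
  by rewrite -fdE.
have dE : derive1 f t = d by rewrite derive1E.
apply/cvgrPdist_le => /= e e0.
move/cvgrPdist_le : H => /(_ _ e0)[/= r r0] H.
exists r => //= s; rewrite /ball_/= /slope dE => ts.
case: eqVneq => [_|st]; first by rewrite subrr normr0 ltW.
have := H (s - t); rewrite /ball_/= sub0r opprB scaler1 subrK; apply => //.
by rewrite subr_eq0.
Qed.

Lemma is_derive_incr (f : R -> R) (t d : R) : is_derive t 1 f d -> 0 < d ->
  \forall s \near t, s != t -> 0 < (f s - f t) * (s - t).
Proof.
move=> fd d0; have := cvg_slope fd.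
move=> /cvgr_gt /(_ _ d0); apply: filterS => s + st.
rewrite (slopeE f t s) addrC addKr => s0.
by rewrite mulrAC pmulr_lgt0// -expr2 exprn_even_gt0//= subr_eq0.
Qed.

(** By the mean value theorem [f s - f t = g c * (s - t)] with [c] between, and [g c] has the sign
    of [c - t]. The second derivative is needed at [t] only. *)
Lemma second_derivative_test (f g : R -> R) (t d : R) :
  (forall s : R, is_derive s 1 f (g s)) -> g t = 0 -> is_derive t 1 g d -> 0 < d ->
  \forall s \near t, f t <= f s.
Proof.
move=> fg gt0 gd d0; have := is_derive_incr gd d0.
rewrite -!nbhs_nearE => /nbhs_ballP[e /= e0 H]; apply/nbhs_ballP; exists e => //= s.
rewrite /ball/= => st.
have fc (a b : R) : {within `[a, b], continuous f}.
  apply: continuous_subspaceT => x.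
  by apply/differentiable_continuous/derivable1_diffP; case: (fg x).
have [ts|ts|->//] := ltgtP t s.
  have [c /[!in_itv]/= /andP[tc cs] fE] := MVT ts (fun x _ => fg x) (fc _ _).
  rewrite -subr_ge0 fE.
  have : 0 < (g c - g t) * (c - t).
    by apply: H; [rewrite /ball/= ltr_distlC; move: st; rewrite ltr_distlC; lra | lra].
  by rewrite gt0 subr0 pmulr_lgt0 ?subr_gt0// => gc; rewrite mulr_ge0; lra.
have [c /[!in_itv]/= /andP[tc cs] fE] := MVT ts (fun x _ => fg x) (fc _ _).
rewrite -subr_le0 fE.
have : 0 < (g c - g t) * (c - t).
  by apply: H; [rewrite /ball/= ltr_distlC; move: st; rewrite ltr_distlC; lra | lra].
by rewrite gt0 subr0 => gc; nra.
Qed.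

Lemma is_derive_0_cst (f : R -> R) : (forall t : R, is_derive t 1 f 0) ->
  forall s t, f s = f t.
Proof. by move=> f0 s t; apply: is_derive_0_is_cst. Qed.

Lemma is_derive_line n (f : 'rV[R]_n -> R) (x v : 'rV[R]_n) (d : R) :
  is_derive x v f d -> is_derive (0 : R) 1 (fun h => f (h *: v + x)) d.
Proof.
case=> fd fdE; split; first exact: (derivable1P f x v).1 fd.
rewrite -fdE /derive; under eq_fun do rewrite /= scaler1 addr0 scale0r add0r.
by [].
Qed.

Lemma is_derive_translate (f : R -> 'rV[R]_2) (t : R) (df : 'rV[R]_2) :
  is_derive t 1 f df -> is_derive (0 : R) 1 (fun h => f (h + t)) df.
Proof.
move=> [fd fdE]; split.
  by rewrite /derivable; under eq_fun do rewrite /= addr0 add0r.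
by rewrite -fdE /derive; under eq_fun do rewrite /= addr0 add0r.
Qed.

(** The squared norm is a quarter of the square of the given function, so its derivative vanishes
    too; squaring avoids differentiating the root. *)
Lemma critical_enorm (f : R -> 'rV[R]_2) (df : 'rV[R]_2) :
  is_derive (0 : R) 1 f df ->
  is_derive (0 : R) 1 (fun h => - enorm (f h) - enorm (f h)) 0 ->
  dot (f 0) df = 0.
Proof.
move=> fd /(is_deriveX 1) => H.
have dd := is_derive_dot fd fd.
have E : (fun s => dot (f s) (f s)) =
    2^-1 ^+ 2 *: (fun h => - enorm (f h) - enorm (f h)) ^+ 2.
  apply/funext => s; rewrite -enorm_sqr.
  transitivity (2^-1 ^+ 2 * (- enorm (f s) - enorm (f s)) ^+ 2); last by [].
  by field.
have : is_derive (0 : R) 1 (fun s => dot (f s) (f s)) 0.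
  by rewrite E; apply: is_derive_eq; rewrite !scaler0.
move=> /@derive_val; have /@derive_val -> := dd.
by rewrite (dotC df); lra.
Qed.

End Derivatives.

(** * The boundary of the table *)

Section Boundary.
Context {R : realType} {P : R} {gamma : R -> 'rV[R]_2} {K : set 'rV[R]_2}.
Hypothesis table : bounds_convex_table P gamma K.

Let curve := table_curve table.
Local Notation T := (derive1 gamma).
Local Notation N t := (rot90 (derive1 gamma t)).
Local Notation k := (curvature gamma).

Lemma is_derive_gamma (t : R) : is_derive t 1 gamma (T t).
Proof. by rewrite derive1E; apply: derivableP; case: (curve_C1 curve). Qed.

Lemma dot_tangent t : dot (T t) (T t) = 1.
Proof. by rewrite -enorm_sqr (curve_unit_speed curve) expr1n. Qed.

(** Frenet's equation: unit speed makes [T'] orthogonal to [T], leaving only the normal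
    component. *)
Lemma is_derive_tangent (t : R) : is_derive t 1 T (k t *: N t).
Proof.
have dT : is_derive t 1 T (derive1 T t).
  by rewrite derive1E; apply: derivableP; case: (curve_C2 curve).
have : is_derive t 1 (fun s => dot (T s) (T s)) 0.
  by under eq_fun do rewrite dot_tangent; exact: is_derive_cst.
move=> /@derive_val; have /@derive_val -> := is_derive_dot dT dT => TT'.
rewrite [X in is_derive _ _ _ X](_ : _ = derive1 T t)//.
rewrite [RHS](dot_unit _ (dot_tangent t)).
suff -> : dot (derive1 T t) (T t) = 0 by rewrite scale0r add0r.
by move: TT'; rewrite !dotE; lra.
Qed.

Lemma is_derive_normal (t : R) : is_derive t 1 (fun s => N s) (- k t *: T t).
Proof.
have -> : - k t *: T t = rot90 (k t *: N t) by apply: rV2P; rewrite !coordE; ring.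
exact/is_derive_rot90/is_derive_tangent.
Qed.

Lemma cvg_gamma t : gamma s @[s --> t] --> gamma t.
Proof.
apply/differentiable_continuous/derivable1_diffP.
by case: (is_derive_gamma t).
Qed.

Lemma cvg_tangent t : T s @[s --> t] --> T t.
Proof. by case: (curve_C1 curve) => _; exact. Qed.

Lemma cvg_normal t : N s @[s --> t] --> N t.
Proof. by apply: cvg_rot90; exact: cvg_tangent. Qed.

Lemma continuous_curvature : continuous k.
Proof.
move=> t; apply: cvg_dot; last exact: cvg_normal.
by case: (curve_C2 curve) => _; exact.
Qed.

Lemma gamma_periodz t (m : int) : gamma (t + m%:~R * P) = gamma t.
Proof.
have pn (n : nat) s : gamma (s + n%:R * P) = gamma s.
  elim: n s => [|n ih] s; first by rewrite mul0r addr0.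
  by rewrite -natr1 mulrDl mul1r addrA (curve_periodic curve).
case: m => n; first by rewrite -pmulrn pn.
by rewrite NegzE mulrNz mulNr -pmulrn -[LHS](pn n.+1) subrK.
Qed.

Lemma same_pt_gamma s t : same_pt P s t -> gamma s = gamma t.
Proof. by move=> [m mE]; rewrite -(subrK t s) mE addrC gamma_periodz. Qed.

Lemma table_closed : closed K.
Proof. by apply: compact_closed (table_compact table); exact: norm_hausdorff. Qed.

Lemma gamma_boundary t : K (gamma t) /\ ~ K° (gamma t).
Proof.
have : range gamma (gamma t) by exists t.
by rewrite -(table_boundary table) -(closure_id K).1//; exact: table_closed.
Qed.

Lemma table_conv p q (l : R) : K p -> K q -> 0 <= l <= 1 ->
  K (l *: p + (1 - l) *: q).
Proof.
move=> Kp Kq /andP[l0 l1].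
have := table_convex table (Itv01 l0 l1) (mem_set Kp) (mem_set Kq).
by rewrite inE.
Qed.

(** The homothety of centre [p] and ratio [l] carries a neighbourhood of [m] inside [K] to one of
    the combination. *)
Lemma interior_conv (p m : 'rV[R]_2) (l : R) : K p -> K° m -> 0 < l <= 1 ->
  K° (l *: m + (1 - l) *: p).
Proof.
move=> Kp Km /andP[l0 l1].
have : \forall q \near (l *: m + (1 - l) *: p),
    K (l^-1 *: (q - (1 - l) *: p)).
  have : l^-1 *: (q - (1 - l) *: p) @[q --> (l *: m + (1 - l) *: p)] --> m.
    rewrite [X in _ --> X](_ : m = l^-1 *: ((l *: m + (1 - l) *: p) - (1 - l) *: p)).
      exact: cvgZ (cvg_cst _) (cvgB cvg_id (cvg_cst _)).
    by rewrite addrK scalerA mulVf ?scale1r ?gt_eqF.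
  by move=> /(_ _ Km).
apply: filterS => q Kq.
have -> : q = l *: (l^-1 *: (q - (1 - l) *: p)) + (1 - l) *: p.
  by rewrite scalerA mulfV ?gt_eqF// scale1r subrK.
by apply: table_conv => //; rewrite ltW.
Qed.

(* If p lies strictly below the tangent line at t then gamma t is a convex
   combination of p, of a curve point slightly beyond gamma t as seen from p,
   and of a point m' close to the interior point m on the inner normal. *)
Lemma support_ge0 (p : 'rV[R]_2) t : K p -> 0 <= dot (p - gamma t) (N t).
Proof.
move=> Kp; rewrite leNgt; apply/negP => p0.
have [e [e0 Ke]] := filter_ex (filterI (nbhs_right_gt 0)
  (table_positively_oriented table t)).
set a := dot (p - gamma t) (T t); set b := - dot (p - gamma t) (N t).
have b0 : 0 < b by rewrite /b; lra.
have pE : p = gamma t + (a *: T t - b *: N t).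
  have := dot_unit (p - gamma t) (dot_tangent t).
  by rewrite /b scaleNr opprK => <-; rewrite addrC subrK.
(* [m' mu] and the point [r] below differ from [gamma t] by multiples of one vector,
   [(p - gamma t) - a *: slope], with coefficients [- e / b] and [mu / (1 + mu)]. The opposite signs
   put [gamma t] between them; the weight [l] balances the two. *)
pose m' (mu : R) := gamma t - (e / b) *: ((p - gamma t) - a *: slope gamma t (t - mu * a)).
have ct : t - mu * a @[mu --> (0 : R)] --> t.
  have : t - mu * a @[mu --> (0 : R)] --> t - 0 * a.
    exact: cvgB (cvg_cst _) (cvgM cvg_id (cvg_cst _)).
  by rewrite mul0r subr0.
have cm' : m' mu @[mu --> (0 : R)] --> gamma t + e *: N t.
  have -> : gamma t + e *: N t = gamma t - (e / b) *: ((p - gamma t) - a *: T t).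
    have -> : p - gamma t = a *: T t - b *: N t by rewrite {1}pE addrC addKr.
    by rewrite addrAC subrr add0r scalerN opprK scalerA divfK ?gt_eqF.
  have cs : slope gamma t (t - mu * a) @[mu --> (0 : R)] --> T t.
    exact: cvg_comp ct (cvg_slope (is_derive_gamma t)).
  exact: cvgB (cvg_cst _)
    (cvgZ (cvg_cst _) (cvgB (cvg_cst _) (cvgZ (cvg_cst _) cs))).
have Km' : \forall mu \near 0^'+, K° (m' mu).
  by apply: cvg_within; apply: cm'; exact: nbhs_interior.
have [mu [mu0 Km]] := filter_ex (filterI (nbhs_right_gt 0) Km').
have := gamma_boundary t; case=> Kt; apply => /=.
set q := gamma (t - mu * a); have Kq : K q by have [] := gamma_boundary (t - mu * a).
have qE : q = gamma t - (mu * a) *: slope gamma t (t - mu * a).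
  by rewrite /q (slopeE gamma t) addrAC subrr add0r scaleNr.
set sl := slope _ _ _ in Km qE.
pose r := (1 + mu)^-1 *: q + (1 - (1 + mu)^-1) *: p.
have Kr : K r.
  by apply: table_conv => //; rewrite invr_ge0 invf_le1; lra.
pose l := (mu * b / e) / (1 + mu + mu * b / e).
have c0 : 0 < mu * b / e by rewrite divr_gt0 ?mulr_gt0.
have -> : gamma t = l *: m' mu + (1 - l) *: r.
  rewrite /r qE /l /m' -/sl; set g := gamma t.
  apply: rV2P; rewrite !coordE; field; rewrite ?gt_eqF//=; nra.
apply: interior_conv => //; apply/andP; split; first by rewrite divr_gt0//; lra.
by rewrite ler_pdivrMr; lra.
Qed.

End Boundary.
Arguments cvg_gamma {R P gamma K} table t.
Arguments cvg_tangent {R P gamma K} table t.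
Arguments cvg_normal {R P gamma K} table t.

(** Otherwise the intermediate value [m / 2], which is excluded, would be attained. *)
Lemma continuous_gap_gt0 (R : realType) (f : R -> R) (m s t : R) :
  continuous f -> 0 < m -> (forall r, f r = 0 \/ m <= f r) -> f s != 0 ->
  0 < f t.
Proof.
move=> fc m0 fm fs.
have {}fs : m <= f s by case: (fm s) fs => [->|]; rewrite ?eqxx.
case: (fm t) => [ft|]; last exact: lt_le_trans.
have fw (a b : R) : {within `[a, b], continuous f}.
  exact: continuous_subspaceT.
have fs0 : 0 <= f s by lra.
have [c cE] : exists c, f c = m / 2.
  have [st|ts] := leP s t.
    have [|c _ fcE] := IVT (v := m / 2) st (fw _ _); last by exists c.
    by rewrite ft min_r// max_l//; lra.
  have [|c _ fcE] := IVT (v := m / 2) (ltW ts) (fw _ _); last by exists c.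
  by rewrite ft min_l// max_r//; lra.
by case: (fm c); lra.
Qed.

(** * Positive curvature and strict convexity from the evolute *)

Section StrictConvexity.
Context {R : realType} {P : R} {gamma : R -> 'rV[R]_2} {K : set 'rV[R]_2}.
Hypothesis table : bounds_convex_table P gamma K.
Hypothesis evoluteK : evolute gamma `<=` K.

Let curve := table_curve table.
Local Notation T := (derive1 gamma).
Local Notation N t := (rot90 (derive1 gamma t)).
Local Notation k := (curvature gamma).

Lemma dot_normal t : dot (N t) (N t) = 1.
Proof. by have := dot_tangent table t; rewrite !coordE; lra. Qed.

Lemma table_bounded : exists2 M : R, 0 < M & forall p, K p -> forall i, `|p 0 i| <= M.
Proof.
have [M [_ KM]] := compact_bounded (table_compact table).
exists (`|M| + 1) => [|p Kp i]; first by rewrite ltr_pwDr.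
apply: le_trans (KM (`|M| + 1) _ p Kp); last by rewrite ltr_pwDr// ler_norm.
rewrite [leRHS]/Num.Def.normr/= mx_normrE.
exact: (le_bigmax _ (fun ij => `|p ij.1 ij.2|) (0, i)).
Qed.

(** The centre of curvature lies in the table, hence on the inner side of every tangent line; its
    own tangent line gives the sign of [k t]. *)
Lemma evolute_curvature t : k t != 0 -> 0 < k t /\
  forall s, dot (gamma t - gamma s) (N s) + (k t)^-1 * dot (N t) (N s) >= 0.
Proof.
move=> kt; set c : 'rV[R]_2 := gamma t + (k t)^-1 *: N t.
have Kc : K c by apply: evoluteK; exists t.
have kc s : 0 <= dot (gamma t - gamma s) (N s) + (k t)^-1 * dot (N t) (N s).
  have -> : dot (gamma t - gamma s) (N s) + (k t)^-1 * dot (N t) (N s) =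
      dot (c - gamma s) (N s) by rewrite /c !dotl; ring.
  exact: (support_ge0 table s Kc).
split=> //; have := kc t; rewrite dot_normal mulr1 subrr.
by rewrite dot0l add0r invr_ge0 lt0r kt.
Qed.

Lemma curvature_gap : exists2 m : R, 0 < m & forall t, k t = 0 \/ m <= k t.
Proof.
have [M M0 KM] := table_bounded.
(* Two points of the table differ by at most [2 * M] in each coordinate, so a radius of curvature is
   at most [sqrt 8 * M < 3 * M]. *)
exists (3 * M)^-1 => [|t]; first by rewrite invr_gt0; lra.
have [->|kt] := eqVneq (k t) 0; [by left | right].
have [k0 _] := evolute_curvature kt.
rewrite invf_ple ?posrE//; last by lra.
set c : 'rV[R]_2 := gamma t + (k t)^-1 *: N t.
have Kc : K c by apply: evoluteK; exists t.
have Kt : K (gamma t) by have [] := gamma_boundary table t.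
have ki : 0 < (k t)^-1 by rewrite invr_gt0.
have kE : (k t)^-1 * (k t)^-1 = dot (c - gamma t) (c - gamma t).
  by rewrite /c addrAC subrr add0r !dotl dot_normal mulr1.
move: kE; rewrite dotE ![(_ - gamma t) 0 _]mxE ![(- gamma t) 0 _]mxE.
move: (KM _ Kc 0) (KM _ Kc 1) (KM _ Kt 0) (KM _ Kt 1).
rewrite !ler_norml => /andP[c1 c2] /andP[c3 c4] /andP[g1 g2] /andP[g3 g4] kE.
have e1 : (c 0 0 - gamma t 0 0) ^+ 2 <= 4 * M ^+ 2 by nra.
have e2 : (c 0 1 - gamma t 0 1) ^+ 2 <= 4 * M ^+ 2 by nra.
have : (k t)^-1 ^+ 2 <= (3 * M) ^+ 2 by nra.
by rewrite ler_pXn2r// nnegrE; lra.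
Qed.

(** With zero curvature [T] is constant and [gamma] affine; periodicity then forces [T = 0], against
    unit speed. *)
Lemma curvature_neq0 : exists t, k t != 0.
Proof.
apply/not_existsP => k0.
have {}k0 t : k t = 0 by apply/eqP; apply: contrapT => /negP; exact: k0.
have Tcst t i : T t 0 i = T 0 0 i.
  apply: (is_derive_0_cst (f := fun t => T t 0 i)) => s.
  have := is_derive_tangent table s; rewrite k0 scale0r => /is_derive_mx/(_ 0 i).
  by rewrite mxE.
have T0 i : T 0 0 i = 0.
  have lin : forall s t, gamma s 0 i - s * T 0 0 i = gamma t 0 i - t * T 0 0 i.
    apply: (is_derive_0_cst (f := fun s => gamma s 0 i - s * T 0 0 i)) => s.
    have /is_derive_mx/(_ 0 i) := is_derive_gamma table s => dg.
    have := is_deriveB dg (is_deriveM (is_derive_id s 1) (is_derive_cst (T 0 0 i) s 1)).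
    by rewrite Tcst scaler0 add0r /GRing.scale/= mulr1 subrr.
  have := lin (0 + P) 0; rewrite (curve_periodic curve) add0r mul0r subr0.
  move=> /eqP; rewrite subr_eq addrC -subr_eq subrr eq_sym mulf_eq0.
  by rewrite (gt_eqF (curve_period_gt0 curve)) => /eqP.
have := dot_tangent table 0; rewrite dotE !T0 mulr0 addr0 => /eqP.
by rewrite eq_sym oner_eq0.
Qed.

(* The curvature is 0 or bounded away from 0, since the evolute stays in the
   bounded table; by connectedness it cannot take both kinds of values, and it
   does not vanish identically on a closed curve. *)
Lemma curvature_gt0 t : 0 < k t.
Proof.
have [m m0 km] := curvature_gap; have [s ks] := curvature_neq0.
exact: continuous_gap_gt0 (continuous_curvature table) m0 km ks.
Qed.

(* F r := <gamma s - gamma r, N r> is nonnegative; if it vanishes at t then so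
   does its derivative - k t * <gamma s - gamma t, T t>, whence
   gamma s = gamma t. *)
Lemma strict_support s t : ~ same_pt P s t -> 0 < dot (gamma s - gamma t) (N t).
Proof.
move=> st; rewrite lt0r (support_ge0 table) ?andbT; last first.
  by case: (gamma_boundary table s).
apply/eqP => F0; apply: st; apply: (curve_simple curve).
have dF (r : R) : is_derive r 1 (fun r => dot (gamma s - gamma r) (N r))
    (- k r * dot (gamma s - gamma r) (T r)).
  have -> : - k r * dot (gamma s - gamma r) (T r) =
      dot (0 - T r) (N r) + dot (gamma s - gamma r) (- k r *: T r).
    by rewrite !coordE; ring.
  apply: is_derive_dot; last exact: (is_derive_normal table).
  by apply: is_deriveB; exact: (is_derive_gamma table).
have : is_derive t 1 (fun r => dot (gamma s - gamma r) (N r)) 0.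
  apply: (@derive1_at_min _ _ (t - 1) (t + 1)).
  - by lra.
  - by move=> r _; case: (dF r).
  - by rewrite in_itv/=; lra.
  - by move=> r _; rewrite F0; apply: (support_ge0 table); case: (gamma_boundary table s).
move=> /@derive_val; have /@derive_val -> := dF t => /eqP.
rewrite mulf_eq0 oppr_eq0 (gt_eqF (curvature_gt0 t))/= => /eqP FT.
have := dot_unit (gamma s - gamma t) (dot_tangent table t).
by rewrite FT F0 !scale0r addr0 => /eqP; rewrite subr_eq0 => /eqP.
Qed.

Lemma not_same_pt (s t : R) : s < t < s + P -> ~ same_pt P s t.
Proof.
move=> /andP[st tsP] [m mE]; have P0 := curve_period_gt0 curve.
have : -1 < m%:~R :> R by rewrite -(ltr_pM2r P0) -mE; lra.
have : m%:~R < 0 :> R by rewrite -(ltr_pM2r P0) -mE; lra.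
rewrite ltrz0 -[-1]/((-1)%:~R) ltr_int; lia.
Qed.

Lemma same_ptC (s t : R) : same_pt P s t -> same_pt P t s.
Proof. by move=> [m mE]; exists (- m); rewrite mulrNz mulNr -mE opprB. Qed.

End StrictConvexity.

(** * Double normals and the mountain pass *)

Section DoubleNormal.
Context {R : realType} {P : R} {gamma : R -> 'rV[R]_2} {K : set 'rV[R]_2}.
Hypothesis table : bounds_convex_table P gamma K.

Let curve := table_curve table.
Local Notation T := (derive1 gamma).
Local Notation N t := (rot90 (derive1 gamma t)).
Local Notation k := (curvature gamma).

Lemma tangent_periodz t (m : int) : T (t + m%:~R * P) = T t.
Proof. by apply: derive1_periodic => s; exact: (gamma_periodz table). Qed.

Definition double_normal (u v l : R) :=
  [/\ 0 < l, gamma v - gamma u = l *: N u & T v = - T u].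

Lemma double_normal_sym u v l : double_normal u v l -> double_normal v u l.
Proof.
case=> l0 uv Tvu; split; [exact: l0 | | by rewrite Tvu opprK].
by rewrite -opprB uv Tvu rot90N scalerN.
Qed.

Lemma double_normal_shift u v l (m n : int) : double_normal u v l ->
  double_normal (u + m%:~R * P) (v + n%:~R * P) l.
Proof.
by rewrite /double_normal !(gamma_periodz table) !tangent_periodz.
Qed.

Lemma double_normal_enorm u v l : double_normal u v l ->
  enorm (gamma v - gamma u) = l.
Proof.
case=> l0 -> _; rewrite /enorm !dotl (dot_normal table) mulr1 -expr2.
by rewrite sqrtr_sqr gtr0_norm.
Qed.

Lemma normal_chord u v : ~ same_pt P u v -> dot (gamma v - gamma u) (T u) = 0 ->
  gamma v - gamma u = enorm (gamma v - gamma u) *: N u.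
Proof.
move=> uv; set D := gamma v - gamma u => Du.
have DE : D = dot D (N u) *: N u.
  by rewrite {1}(dot_unit D (dot_tangent table u)) Du scale0r add0r.
have D0 : 0 <= dot D (N u).
  by apply: (support_ge0 table); case: (gamma_boundary table v).
move: (dot D (N u)) DE D0 => a -> a0.
by rewrite /enorm !dotl (dot_normal table) mulr1 -expr2 sqrtr_sqr ger0_norm.
Qed.

(** Two tangent directions suffice: moving [x^2] alone, and moving [x^1] and [x^3] together. Each
    makes the chord orthogonal to one tangent; convexity fixes the signs. *)
Lemma critical_double_normal x : critical_point P gamma x ->
  double_normal (x 0 0) (x 0 1) (enorm (gamma (x 0 1) - gamma (x 0 0))).
Proof.
case=> -[x31 x12] xcrit.
set u := x 0 0; set v := x 0 1; set D := gamma v - gamma u.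
have g3 h : gamma (h + x 0 ord_max) = gamma (h + u).
  case: x31 => m mE; rewrite -(subrK u (x 0 ord_max)) mE.
  by rewrite addrCA addrC (gamma_periodz table).
have Dv : dot D (T v) = 0.
  have := is_derive_line (xcrit (triple 0 1 0) _).
  rewrite !mxE/= => /(_ erefl).
  have -> : (fun h => L_fun gamma (h *: triple 0 1 0 + x)) =
      fun h => - enorm (gamma (h + v) - gamma u) - enorm (gamma (h + v) - gamma u).
    apply/funext => h; rewrite /L_fun /S_fun /ell !mxE/= !mulr0 !mulr1 !add0r.
    have := g3 0; rewrite !add0r => ->.
    by rewrite -/u -/v -enormN opprB.
  move=> /(critical_enorm (df := T v)); rewrite add0r; apply.
  rewrite -[X in is_derive _ _ _ X]subr0; apply: is_deriveB.
  exact/is_derive_translate/(is_derive_gamma table).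
have Du : dot D (T u) = 0.
  have := is_derive_line (xcrit (triple 1 0 1) _).
  rewrite !mxE/= => /(_ erefl).
  have -> : (fun h => L_fun gamma (h *: triple 1 0 1 + x)) =
      fun h => - enorm (gamma (h + u) - gamma v) - enorm (gamma (h + u) - gamma v).
    apply/funext => h; rewrite /L_fun /S_fun /ell !mxE/= !mulr0 !mulr1 !add0r.
    by rewrite g3 -/u -/v -[in X in _ - X]enormN opprB.
  move=> /(critical_enorm (df := T u)); rewrite add0r => H.
  rewrite /D -opprB dotNl; apply/eqP; rewrite oppr_eq0; apply/eqP; apply: H.
  rewrite -[X in is_derive _ _ _ X]subr0; apply: is_deriveB.
  exact/is_derive_translate/(is_derive_gamma table).
have uv : gamma v - gamma u = enorm D *: N u := normal_chord x12 Du.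
have vu : gamma u - gamma v = enorm D *: N v.
  rewrite -enormN opprB; apply: normal_chord; first by move=> /same_ptC.
  by rewrite -opprB dotNl Dv oppr0.
have D0 : 0 < enorm D.
  rewrite lt0r enorm_ge0 andbT; apply/eqP => /enorm_eq0 /eqP.
  by rewrite subr_eq0 => /eqP/esym/(curve_simple curve).
split; [exact: D0|exact: uv|].
have : enorm D *: (N u + N v) = 0 by rewrite scalerDr -uv -vu -opprB addNr.
move=> /eqP; rewrite scaler_eq0 gt_eqF//= addrC addr_eq0 => /eqP NN.
by rewrite -[T v]opprK -(rot90_rot90 (T v)) NN rot90N rot90_rot90 opprK.
Qed.

(* Near gamma t the curve stays in the disk of radius r tangent to it at
   gamma t, for any r larger than the radius of curvature; this bounds its
   support function. *)
Lemma osculating_support t r : 0 < r -> 1 < r * k t ->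
  \forall s \near t, forall n, dot n n = 1 ->
    dot (gamma s - gamma t) n <= r * (1 + dot (N t) n).
Proof.
move=> r0 rk; set c := gamma t + r *: N t.
pose f s := - dot (gamma s - c) (gamma s - c).
pose g s := - (2 * dot (gamma s - c) (T s)).
have dgc (s : R) : is_derive s 1 (fun s => gamma s - c) (T s).
  rewrite -[X in is_derive _ _ _ X]subr0; apply: is_deriveB.
  exact: (is_derive_gamma table).
have df (s : R) : is_derive s 1 f (g s).
  have -> : g s = - (dot (T s) (gamma s - c) + dot (gamma s - c) (T s)).
    by rewrite /g (dotC (T s)) mulrDl mul1r.
  by apply: is_deriveN; exact: is_derive_dot.
have gc : gamma t - c = - (r *: N t) by rewrite /c opprD addrA subrr add0r.
have g0 : g t = 0.
  by rewrite /g gc dotNl dotZl dotC dot_rot90_self mulr0 oppr0 mulr0 oppr0.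
(* The second derivative of minus the squared distance to [c]; it is positive exactly because [r]
   exceeds the radius of curvature, so that distance has a local maximum at [t]. *)
have dg : is_derive t 1 g (2 * (r * k t - 1)).
  have -> : 2 * (r * k t - 1) =
      - (2 *: (dot (T t) (T t) + dot (gamma t - c) (k t *: N t))).
    rewrite gc (dot_tangent table) !dotl (dot_normal table) /GRing.scale/=.
    by move: (k t) => kt; ring.
  apply: is_deriveN; apply: is_deriveZ.
  exact: is_derive_dot (dgc t) (is_derive_tangent table t).
have /= := second_derivative_test df g0 dg _.
rewrite mulr_gt0 ?subr_gt0// => /(_ isT); apply: filterS => s fs n n1.
have {}fs : dot (gamma s - c) (gamma s - c) <= r ^+ 2.
  by move: fs; rewrite /f gc dotNl dotNr opprK dotZl dotZr (dot_normal table) mulr1 lerN2.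
have -> : dot (gamma s - gamma t) n = dot (gamma s - c) n + r * dot (N t) n.
  by rewrite /c !dotl; ring.
rewrite mulrDr mulr1 lerD2r.
have : dot (gamma s - c) n ^+ 2 <= r ^+ 2.
  by rewrite (le_trans (cauchy_schwarz _ _))// n1 mulr1.
move: (dot _ n) => y yr; nra.
Qed.

End DoubleNormal.

(** * Width of the table near the direction of a double normal *)

Section MountainPass.
Context {R : realType} {P : R} {gamma : R -> 'rV[R]_2} {K : set 'rV[R]_2}.
Hypothesis table : bounds_convex_table P gamma K.
Hypothesis evoluteK : evolute gamma `<=` K.

Local Notation T := (derive1 gamma).
Local Notation N t := (rot90 (derive1 gamma t)).
Local Notation k := (curvature gamma).
Local Notation double_normal := (@double_normal R gamma).

(** The centre of curvature at [u] is on the inner side of the tangent at [v], which is parallel to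
    the tangent at [u] at distance [l]. *)
Lemma double_normal_curvature u v l : double_normal u v l -> 1 <= l * k u.
Proof.
case=> l0 uv Tvu.
have ku := curvature_gt0 table evoluteK u.
have [_ /(_ v)] := evolute_curvature table evoluteK (lt0r_neq0 ku).
rewrite -opprB uv Tvu rot90N dotNl dotZl !dotNr (dot_normal table).
move: (k u) ku => c c0; rewrite mulrN opprK mulr1 mulrN1 subr_ge0.
by rewrite -[c^-1]mul1r ler_pdivrMr.
Qed.

Lemma sqr1_lt0 (c : R) : c < 0 -> c ^+ 2 = 1 -> c = -1.
Proof. by nra. Qed.

Lemma sqrD1_lt1 (x y : R) : x ^+ 2 + y ^+ 2 = 1 -> 0 < y ^+ 2 -> x < 1.
Proof. by nra. Qed.

(** The left side is at most [l - (l - r1 - r2) * (1 - c)]. *)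
Lemma disks_width (l r1 r2 c y z : R) : r1 + r2 < l -> c < 1 ->
  - z <= r1 * (1 - c) -> y <= r2 * (1 - c) -> y - z + l * c < l.
Proof. by nra. Qed.

(* In the direction n of a normal near the end u0 the width is attained between
   two parallel tangents at points u, v close to u0, v0. Comparing with disks of
   radii r1, r2 tangent at u0, v0, it is at most
   r1 + r2 + (l - r1 - r2) * <N u0, n>, which is smaller than l. *)
Lemma small_width u0 v0 l : double_normal u0 v0 l ->
  k u0 + k v0 < l * (k u0 * k v0) ->
  exists n, exists2 w, w < l &
    dot n n = 1 /\ forall s t, dot (gamma s - gamma t) n <= w.
Proof.
move=> [l0 uv Tvu] kl.
have ku := curvature_gt0 table evoluteK u0.
have kv := curvature_gt0 table evoluteK v0.
have [r1 [r2 [r10 r20 kr1 kr2 rl]]] : exists r1 r2 : R,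
    [/\ 0 < r1, 0 < r2, 1 < r1 * k u0, 1 < r2 * k v0 & r1 + r2 < l].
  move: (k u0) (k v0) kl ku kv => c1 c2 kl c10 c20.
  (* A third of the slack is added to each radius of curvature, which leaves a third to spare. *)
  pose e := (l - c1^-1 - c2^-1) / 3.
  have e0 : 0 < e.
    rewrite divr_gt0//.
    have -> : l - c1^-1 - c2^-1 = (l * (c1 * c2) - (c1 + c2)) / (c1 * c2).
      by field; rewrite !gt_eqF.
    by rewrite divr_gt0 ?mulr_gt0// subr_gt0.
  have i1 : 0 < c1^-1 by rewrite invr_gt0.
  have i2 : 0 < c2^-1 by rewrite invr_gt0.
  have eE : e * 3 = l - c1^-1 - c2^-1 by rewrite /e divfK.
  exists (c1^-1 + e), (c2^-1 + e); split; [lra|lra| | |lra].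
    by rewrite mulrDl mulVf ?gt_eqF// ltrDl mulr_gt0.
  by rewrite mulrDl mulVf ?gt_eqF// ltrDl mulr_gt0.
have Nvu : N v0 = - N u0 by rewrite Tvu rot90N.
pose G n s := dot (T s) n.
have dG (n : 'rV[R]_2) (t : R) : is_derive t 1 (G n) (k t * dot (N t) n).
  have -> : k t * dot (N t) n = dot (k t *: N t) n + dot (T t) 0.
    by rewrite dotZl [X in _ + X]dotC dot0l addr0.
  exact: is_derive_dot (is_derive_tangent table t) (is_derive_cst n t 1).
have G0 u : G (N u) u = 0 by exact: dot_rot90_self.
have Gv0 : G (N u0) v0 = 0 by rewrite /G Tvu dotNl dot_rot90_self oppr0.
have near_v : \forall s \near v0,
    [/\ forall n, dot n n = 1 -> dot (gamma s - gamma v0) n <= r2 * (1 + dot (N v0) n),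
        dot (T s) (T u0) < 0 &
        s != v0 -> 0 < (- G (N u0) s) * (s - v0)].
  have n1 := osculating_support table r20 kr2.
  have n2 : \forall s \near v0, dot (T s) (T u0) < 0.
    have : dot (T s) (T u0) @[s --> v0] --> dot (T v0) (T u0).
      exact: cvg_dot (cvg_tangent table _) (cvg_cst _).
    by move=> /cvgr_lt; apply; rewrite Tvu dotNl (dot_tangent table) ltrN10.
  have n3 : \forall s \near v0, s != v0 -> 0 < (- G (N u0) s) * (s - v0).
    have dGN : is_derive v0 1 (fun s => - G (N u0) s) (k v0).
      have := is_deriveN (dG (N u0) v0).
      by rewrite Nvu dotNl (dot_normal table) mulrN1 opprK.
    have := is_derive_incr dGN kv; apply: filterS => s /= + sv => /(_ sv).
    by rewrite Gv0 oppr0 subr0.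
  by near=> s; split; near: s.
have /nbhs_ballP[d /= d0 dv] := near_v.
pose sp := v0 + d / 2; pose sm := v0 - d / 2.
have d20 : 0 < d / 2 by rewrite divr_gt0.
have d2d : d / 2 < d by rewrite ltr_pdivrMr// ltr_pMr// ltr1n.
have vd s : `|v0 - s| < d -> _ := fun h => dv s h.
have smv : sm != v0 by rewrite lt_eqF// ltrBlDr ltrDl.
have spv : sp != v0 by rewrite gt_eqF// ltrDl.
have smE : sm - v0 = - (d / 2) by rewrite /sm addrAC subrr add0r.
have spE : sp - v0 = d / 2 by rewrite /sp addrAC subrr add0r.
have Gsp : G (N u0) sp < 0.
  have [|_ _ /(_ spv)] := vd sp; first by rewrite distrC spE gtr0_norm.
  by rewrite spE pmulr_lgt0// oppr_gt0.
have Gsm : 0 < G (N u0) sm.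
  have [|_ _ /(_ smv)] := vd sm; first by rewrite distrC smE normrN gtr0_norm.
  by rewrite smE mulrNN pmulr_lgt0.
(* The neighbourhood is punctured because [n = N u] must differ from the chord direction. For [u]
   close to [u0] the signs of [G] at [sp] and [sm] persist, so a tangent parallel to that at [u]
   occurs between them. *)
have near_u : \forall u \near u0^',
    [/\ forall n, dot n n = 1 -> dot (gamma u - gamma u0) n <= r1 * (1 + dot (N u0) n),
        0 < dot (T u) (T u0), G (N u0) u != 0,
        G (N u) sp < 0 & 0 < G (N u) sm].
  have cG s : G (N u) s @[u --> u0] --> G (N u0) s.
    exact: cvg_dot (cvg_cst _) (cvg_normal table _).
  have n1 : \forall u \near u0^', forall n, dot n n = 1 ->
      dot (gamma u - gamma u0) n <= r1 * (1 + dot (N u0) n).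
    exact: cvg_within (osculating_support table r10 kr1).
  have n2 : \forall u \near u0^', 0 < dot (T u) (T u0).
    apply: cvg_within.
    have : dot (T s) (T u0) @[s --> u0] --> dot (T u0) (T u0).
      exact: cvg_dot (cvg_tangent table _) (cvg_cst _).
    by move=> /cvgr_gt; apply; rewrite (dot_tangent table).
  have n3 : \forall u \near u0^', G (N u0) u != 0.
    have dGu : is_derive u0 1 (G (N u0)) (k u0).
      by have := dG (N u0) u0; rewrite (dot_normal table) mulr1.
    have := is_derive_incr dGu ku; rewrite near_withinE; apply: filterS => s H su.
    by move: (H su); rewrite G0 subr0; apply: contraTneq => ->; rewrite mul0r ltxx.
  have n4 : \forall u \near u0^', G (N u) sp < 0.
    by apply: cvg_within; move: (cG sp) => /cvgr_lt; apply.
  have n5 : \forall u \near u0^', 0 < G (N u) sm.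
    by apply: cvg_within; move: (cG sm) => /cvgr_gt; apply.
  by near=> u; split; near: u.
have /filter_ex := near_u; move=> /(_ _)[|u]; first exact: Proper_dnbhs_numFieldType.
case=> Du Tu Gu Gup Gum.
have smp : sm <= sp by rewrite lerD2l ge0_cp// ltW.
have Gc : {within `[sm, sp], continuous (G (N u))}.
  apply: continuous_subspaceT => s; apply/differentiable_continuous/derivable1_diffP.
  by case: (dG (N u) s).
have [|v vs Gv] := IVT (v := 0) smp Gc.
  have Gpm := ltW (lt_trans Gup Gum).
  by rewrite min_r// max_l// (ltW Gup) (ltW Gum).
have [|Dv Tv _] := vd v.
  move: vs; rewrite in_itv/= /sm /sp => /andP[v1 v2].
  apply: le_lt_trans d2d; rewrite distrC ler_distl; exact/andP.
have Tvu' : T v = - T u.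
  have TvE : T v = dot (T v) (T u) *: T u.
    by rewrite {1}(dot_unit (T v) (dot_tangent table u)) [dot _ (N u)]Gv scale0r addr0.
  have c2 : dot (T v) (T u) ^+ 2 = 1.
    have := dot_tangent table v; rewrite {1 2}TvE dotZl dotZr (dot_tangent table).
    by rewrite mulr1.
  have c0 : dot (T v) (T u) < 0.
    by move: Tv; rewrite {1}TvE dotZl pmulr_llt0.
  have c1 : dot (T v) (T u) = -1 by exact: sqr1_lt0.
  by rewrite TvE c1; exact: scaleN1r.
have NuNv : N v = - N u := etrans (congr1 _ Tvu') (rot90N _).
exists (N u), (dot (gamma v - gamma u) (N u)).
  have := Dv _ (dot_normal table u).
  have := Du (- N u); rewrite dotNl dotNr opprK (dot_normal table) => /(_ erefl).
  rewrite Nvu !dotNl !dotNr.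
  have -> : dot (gamma v - gamma u) (N u) = dot (gamma v - gamma v0) (N u)
      - dot (gamma u - gamma u0) (N u) + dot (gamma v0 - gamma u0) (N u).
    by rewrite !dotBl; ring.
  rewrite uv dotZl.
  have c2 : dot (N u0) (N u) ^+ 2 + G (N u0) u ^+ 2 = 1.
    rewrite dot_rot90 dotC lagrange_identity (dot_tangent table u).
    by rewrite (dot_tangent table u0) mulr1.
  have c1 : dot (N u0) (N u) < 1.
    have : 0 < G (N u0) u ^+ 2 by rewrite exprn_even_gt0.
    by move: c2; exact: sqrD1_lt1.
  by move=> h1 h2; exact: disks_width rl c1 h1 h2.
split; first exact: (dot_normal table).
move=> s t.
have := support_ge0 table v (gamma_boundary table s).1.
have := support_ge0 table u (gamma_boundary table t).1.
rewrite NuNv dotNr !dotBl !subr_ge0 oppr_ge0 subr_le0 => ut sv.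
exact: lerB.
Unshelve. all: by end_near. Qed.

End MountainPass.

Section PassValue.
Context {R : realType} {P : R} {gamma : R -> 'rV[R]_2} {K : set 'rV[R]_2}.
Hypothesis table : bounds_convex_table P gamma K.
Hypothesis evoluteK : evolute gamma `<=` K.

Local Notation k := (curvature gamma).

Lemma L_fun_chord (x : 'rV[R]_3) : same_pt P (x 0 ord_max) (x 0 0) ->
  L_fun gamma x = - (2 * enorm (gamma (x 0 1) - gamma (x 0 0))).
Proof.
move=> /(same_pt_gamma table) x31.
by rewrite /L_fun /S_fun /ell x31 -enormN opprB; move: (enorm _) => e; ring.
Qed.

(* The component of the chord orthogonal to n changes sign along a pass path,
   so that some chord of the path is parallel to n. *)
Lemma pass_path_width a b sigma n w : pass_path P a b sigma -> dot n n = 1 ->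
  (forall s t, dot (gamma s - gamma t) n <= w) ->
  exists2 s, s \in `[0, 1] & - (2 * w) <= L_fun gamma (sigma s).
Proof.
move=> path n1 nw.
pose D s := gamma (sigma s 0 1) - gamma (sigma s 0 0).
have cD (s : R) : D r @[r --> s] --> D s.
  have cs : sigma r @[r --> s] --> sigma s.
    apply/differentiable_continuous/derivable1_diffP.
    by case: (pass_C1 path).
  have cg (i : 'I_3) : gamma (sigma r 0 i) @[r --> s] --> gamma (sigma s 0 i).
    apply: (cvg_comp (fun r => sigma r 0 i) gamma (cvg_coord cs)).
    exact: (cvg_gamma table).
  exact: cvgB (cg 1) (cg 0).
pose f s := dot (D s) (rot90 n).
have cf : {within `[0, 1], continuous f}.
  by apply: continuous_subspaceT => s; exact: cvg_dot (cD s) (cvg_cst _).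
have D0 : D 0 = gamma b - gamma a.
  rewrite /D (same_pt_gamma table (pass_start path 1)).
  by rewrite (same_pt_gamma table (pass_start path 0)) !mxE.
have D1 : D 1 = - D 0.
  rewrite D0 /D (same_pt_gamma table (pass_end path 1)).
  by rewrite (same_pt_gamma table (pass_end path 0)) !mxE opprB.
have [|s s01 fs] := IVT (v := 0) ler01 cf.
  rewrite /f D1 dotNl; move: (dot _ _) => c.
  rewrite ge_min le_max oppr_le0 oppr_ge0.
  by case/orP: (le_total 0 c) => ->; rewrite !orbT.
have {}s01 : s \in `[0, 1]%classic by rewrite inE.
exists s => //; have [x31 _] := pass_C2Delta path s01.
rewrite (L_fun_chord x31) lerN2 ler_pM2l// -/(D s).
have DE : D s = dot (D s) n *: n.
  by rewrite {1}(dot_unit (D s) n1) [dot _ (rot90 n)]fs scale0r addr0.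
have : `|dot (D s) n| <= w.
  rewrite ler_norml nw andbT lerNl -dotNl opprB; exact: nw.
apply: le_trans; move: DE; move: (dot (D s) n) => c ->.
by rewrite /enorm dotZl dotZr n1 mulr1 -expr2 sqrtr_sqr.
Qed.

Lemma mountain_pass_curvature a b x : mountain_pass_trajectory P gamma a b x ->
  enorm (gamma (x 0 1) - gamma (x 0 0)) * (k (x 0 0) * k (x 0 1))
    <= k (x 0 0) + k (x 0 1).
Proof.
case=> xcrit xval; set u := x 0 0; set v := x 0 1.
set l := enorm (gamma v - gamma u); rewrite leNgt; apply/negP => kl.
have xuv := critical_double_normal table xcrit.
have [n [w wl [n1 nw]]] := small_width table evoluteK xuv kl.
have l0 : 0 < l by case: xuv.
have Lx : L_fun gamma x = - (2 * l) by apply: L_fun_chord; case: xcrit => -[].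
move: xval; rewrite Lx /mountain_pass_value.
set E := [set _ | _ in _] => lE.
(* Without any path [inf] returns 0, which the level [- (2 * l) < 0] rules out. *)
have [E0|E0] := eqVneq E set0.
  move: lE; rewrite E0 inf0 => /eqP.
  by rewrite oppr_eq0 mulf_eq0 pnatr_eq0/= gt_eqF.
have : - (2 * w) <= inf E.
  apply: lb_le_inf; first exact/set0P.
  move=> _ [sigma path <-].
  have [s s01 ws] := pass_path_width path n1 nw.
  apply: le_trans ws _; apply: ub_le_sup; last by exists s => //; rewrite -inE.
  exists 0 => _ [r _ <-]; rewrite /L_fun /S_fun /ell.
  by rewrite -opprD oppr_le0 addr_ge0// enorm_ge0.
by rewrite -lE lerN2 ler_pM2l// leNgt wl.
Qed.

End PassValue.

(** * The billiard map *)

Section Jacobian.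
Context {R : realType}.

Lemma mulmx_rV2 (u : 'rV[R]_2) (M : 'M[R]_2) j :
  (u *m M) 0 j = u 0 0 * M 0 j + u 0 1 * M 1 j.
Proof.
by rewrite mxE big_ord_recl big_ord1; congr (u 0 _ * M _ _ + u 0 _ * M _ _);
  apply: val_inj.
Qed.

Lemma cvg_mulmx_rV2 (T : Type) (F : set_system T) {FF : Filter F}
    (f : T -> 'rV[R]_2) (u : 'rV[R]_2) (M : 'M[R]_2) :
  f x @[x --> F] --> u -> f x *m M @[x --> F] --> u *m M.
Proof.
move=> fu.
have cj (j : 'I_2) : (f x *m M) 0 j @[x --> F] --> (u *m M) 0 j.
  under eq_fun do rewrite mulmx_rV2; rewrite mulmx_rV2.
  by apply: cvgD; apply: cvgM; try exact: cvg_cst; exact: cvg_coord.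
by apply: cvg_rV2; exact: cj.
Qed.

Lemma mul_rV_jacobian (f : 'rV[R]_2 -> 'rV[R]_2) (z v : 'rV[R]_2) :
  v *m jacobian f z = 'd f z v.
Proof. exact: mul_rV_lin1. Qed.

Lemma jacobian_comp (f g : 'rV[R]_2 -> 'rV[R]_2) (z : 'rV[R]_2) :
  differentiable f z -> differentiable g (f z) ->
  jacobian (g \o f) z = jacobian f z *m jacobian g (f z).
Proof.
move=> df dg; apply/row_matrixP => i.
rewrite !rowE mulmxA.
transitivity ('d (g \o f) z (delta_mx 0 i)); first exact: mul_rV_jacobian.
transitivity ('d g (f z) ('d f z (delta_mx 0 i))).
  exact: (congr1 (fun h => h (delta_mx 0 i)) (diff_comp df dg)).
symmetry; transitivity ('d f z (delta_mx 0 i) *m jacobian g (f z)).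
  by congr (_ *m _); exact: mul_rV_jacobian.
exact: mul_rV_jacobian.
Qed.

(** An exact linear expression of the increment, with coefficients converging at [z0], leaves an
    error [(z - z0) *m (M z - M0)] of order o([z - z0]). *)
Lemma caratheodory_jacobian (f : 'rV[R]_2 -> 'rV[R]_2) (z0 : 'rV[R]_2)
    (M : 'rV[R]_2 -> 'M[R]_2) (M0 : 'M[R]_2) :
  (\forall z \near z0, f z = f z0 + (z - z0) *m M z) ->
  (forall i j, M z i j @[z --> z0] --> M0 i j) ->
  differentiable f z0 /\ jacobian f z0 = M0.
Proof.
move=> fM MM0.
have cont : continuous (mulmxr M0 : 'rV[R]_2 -> 'rV[R]_2).
  by move=> u; have := @cvg_mulmx_rV2 _ (nbhs u) _ id u M0 cvg_id; exact.
have lit : f \o shift z0 =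
    cst (f z0) + (mulmxr M0 : 'rV[R]_2 -> 'rV[R]_2) +o_ (0 : 'rV[R]_2) id.
  apply/eqaddoP => e e0.
  have e20 : 0 < e / 2 by rewrite divr_gt0.
  have Mij i j : \forall z \near z0, `|M0 i j - M z i j| <= e / 2.
    by move/cvgrPdist_le : (MM0 i j) => /(_ _ e20).
  have M2 : \forall z \near z0, forall i j, `|M0 i j - M z i j| <= e / 2.
    have FF : Filter (nbhs z0) by exact: nbhs_filter.
    exact: filter_forall FF (fun i => filter_forall FF (Mij i)).
  have : \forall z \near z0, `|f z - (f z0 + (z - z0) *m M0)| <= e * `|z - z0|.
    near=> z.
    have -> : f z = f z0 + (z - z0) *m M z by near: z.
    have Mz : forall i j, `|M0 i j - M z i j| <= e / 2 by near: z.
    rewrite opprD addrACA subrr add0r -mulmxBr; set h := z - z0.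
    rewrite [leLHS]/Num.Def.normr/= mx_normrE.
    apply: bigmax_le => [|[i j] _]; first by rewrite mulr_ge0// ltW.
    rewrite ord1/= mulmx_rV2 ![(M z - M0) _ _]mxE ![(- M0) _ _]mxE.
    have h0 (i' : 'I_2) : `|h 0 i'| <= `|h|.
      rewrite [leRHS]/Num.Def.normr/= mx_normrE.
      exact: (le_bigmax _ (fun ij => `|h ij.1 ij.2|) (0, i')).
    rewrite (le_trans (ler_normD _ _))// !normrM (splitr e) mulrDl.
    by apply: lerD; rewrite [leRHS]mulrC ler_pM// distrC.
  rewrite (near_shift (0 : 'rV[R]_2)) => H; apply: filterS H => h /=.
  by rewrite subr0 addrK.
have dE : 'd f z0 = (mulmxr M0 : 'rV[R]_2 -> 'rV[R]_2) :> ('rV[R]_2 -> 'rV[R]_2).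
  exact: diff_unique cont lit.
split; first by apply/diff_locallyP; rewrite dE.
apply/row_matrixP => i; rewrite !rowE mul_rV_jacobian.
exact: (congr1 (fun g => g (delta_mx 0 i)) dE).
Unshelve. all: by end_near. Qed.

(** Cramer's rule: the characteristic polynomial at [a] annihilates both coordinates of an
    eigenvector. *)
Lemma eigenvalue_mx2 (F : fieldType) (A : 'M[F]_2) (a : F) : eigenvalue A a ->
  a ^+ 2 - (A 0 0 + A 1 1) * a + (A 0 0 * A 1 1 - A 0 1 * A 1 0) = 0.
Proof.
case/eigenvalueP => v vA v0.
have E (j : 'I_2) : v 0 0 * A 0 j + v 0 1 * A 1 j = a * v 0 j.
  have := congr1 (fun w : 'rV[F]_2 => w 0 j) vA.
  rewrite mxE big_ord_recl big_ord1 mxE => <-.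
  by congr (v 0 _ * A _ _ + v 0 _ * A _ _); apply: val_inj.
set d := (X in X = 0); apply/eqP; apply: contraNT v0 => d0.
have z0 : v 0 0 = 0.
  apply: (mulfI d0); rewrite mulr0 /d; have := E 0; have := E 1.
  move: (v 0 0) (v 0 1) => x y e1 e0.
  have -> : (a ^+ 2 - (A 0 0 + A 1 1) * a + (A 0 0 * A 1 1 - A 0 1 * A 1 0)) * x =
    (A 1 1 - a) * (x * A 0 0 + y * A 1 0 - a * x) - A 1 0 * (x * A 0 1 + y * A 1 1 - a * y).
    by ring.
  by rewrite e0 e1 !subrr !mulr0 subrr.
have z1 : v 0 1 = 0.
  apply: (mulfI d0); rewrite mulr0 /d; have := E 0; have := E 1.
  move: (v 0 0) (v 0 1) => x y e1 e0.
  have -> : (a ^+ 2 - (A 0 0 + A 1 1) * a + (A 0 0 * A 1 1 - A 0 1 * A 1 0)) * y =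
    (A 0 0 - a) * (x * A 0 1 + y * A 1 1 - a * y) - A 0 1 * (x * A 0 0 + y * A 1 0 - a * x).
    by ring.
  by rewrite e0 e1 !subrr !mulr0 subrr.
apply/eqP/rowP => i; rewrite mxE; case: i => -[|[|//]] i.
  by rewrite (_ : Ordinal i = 0)//; exact: val_inj.
by rewrite (_ : Ordinal i = 1)//; exact: val_inj.
Qed.

(* If the real quadratic X^2 - t X + 1 has discriminant t^2 - 4 <= 0, its roots
   are conjugate of product 1. *)
Lemma stable_mx2 (A : 'M[R]_2) :
  A 0 0 * A 1 1 - A 0 1 * A 1 0 = 1 -> (A 0 0 + A 1 1) ^+ 2 <= 4 ->
  forall z : R[i], eigenvalue (map_mx (real_complex R) A) z -> `|z| <= 1.
Proof.
move=> detA trA z /eigenvalue_mx2; rewrite !mxE -!rmorphM -rmorphB -rmorphD/= detA.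
move: (A 0 0 + A 1 1) trA => t t4; case: z => x y.
rewrite /real_complex_def; simpc => /eqP; rewrite eq_complex/= => /andP[/eqP e1 /eqP e2].
rewrite -[leRHS]sqrtr1 ler_wsqrtr//.
have [y0|y0] := eqVneq y 0; first by rewrite y0 in e1 *; nra.
have : (2 * x - t) * y = 0 by rewrite -e2; ring.
by move=> /eqP; rewrite mulf_eq0 (negPf y0) orbF => /eqP xt; nra.
Qed.

End Jacobian.

Section Angle.
Context {R : realType}.

Lemma acos_itv (c : R) : -1 < c < 1 -> 0 < acos c < pi.
Proof.
by move=> /andP[c1 c2]; rewrite acos_gt0 ?acos_ltpi// ?c1 ?c2 ?ltW.
Qed.

Lemma angle_unit (p d : 'rV[R]_2) : dot p p = 1 ->
  angle p d = acos (dot p d / enorm d).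
Proof. by move=> p1; rewrite /angle {1}/enorm p1 sqrtr1 mul1r. Qed.

Lemma cos_angle (p d : 'rV[R]_2) : dot p p = 1 -> 0 < enorm d ->
  cos (angle p d) = dot p d / enorm d.
Proof.
move=> p1 d0; rewrite angle_unit// acosK// in_itv/=.
rewrite -ler_norml normf_div (gtr0_norm d0) ler_pdivrMr// mul1r.
rewrite -ler_sqr ?nnegrE// ?enorm_ge0// real_normK ?num_real// enorm_sqr.
by rewrite (le_trans (cauchy_schwarz _ _))// p1 mul1r.
Qed.

Lemma colinear_normal (e e' n n' y : R) : 0 < e -> 0 < e' -> 0 < n -> 0 < n' ->
  n ^+ 2 = e ^+ 2 * y -> n' ^+ 2 = e' ^+ 2 * y -> n' = e' / e * n.
Proof.
move=> e0 e'0 n0 n'0 nE n'E.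
have p0 : 0 < e' / e * n by rewrite mulr_gt0 ?divr_gt0.
apply/eqP; rewrite -(@eqrXn2 _ 2 _ _ isT (ltW n'0) (ltW p0)).
by rewrite exprMn nE n'E expr_div_n; apply/eqP; field; rewrite gt_eqF.
Qed.

(** Used for two later bounces [D] and [c *: D] on one ray, with [p], [q] the components of [D]
    along the normals at these bounces. The support inequalities at the first force [c < 1], those
    at the second [c > 1]. *)
Lemma chord_order (c p q : R) : 0 < c ->
  0 < c * p - p -> 0 < q - c * q -> 0 < - (c * q) -> 0 < - p -> False.
Proof.
move=> c0 cp cq; rewrite oppr_gt0 pmulr_rlt0// oppr_gt0 => q0 p0.
have c1 : c < 1 by nra.
nra.
Qed.

End Angle.

Section Billiard.
Context {R : realType} {P : R} {gamma : R -> 'rV[R]_2} {K : set 'rV[R]_2}.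
Hypothesis table : bounds_convex_table P gamma K.
Hypothesis evoluteK : evolute gamma `<=` K.

Let curve := table_curve table.
Local Notation T := (derive1 gamma).
Local Notation N t := (rot90 (derive1 gamma t)).

Lemma chord_gt0 (s t : R) : s < t < s + P -> 0 < enorm (gamma t - gamma s).
Proof.
move=> st; rewrite lt0r enorm_ge0 andbT; apply/eqP => /enorm_eq0/eqP.
rewrite subr_eq0 => /eqP/esym/(curve_simple curve).
exact: not_same_pt table _ _ st.
Qed.

(** Trades angles for inner products; [|y| < 1] accounts for the condition that phi lies strictly
    between 0 and pi. *)
Lemma billiard_stepP (z : 'rV[R]_2) (w : 'rV[R]_2) : -1 < z 0 1 < 1 ->
  let D := gamma (w 0 0) - gamma (z 0 0) in
  billiard_step P gamma z w <->
  [/\ z 0 0 < w 0 0 < z 0 0 + P, dot (T (z 0 0)) D = - z 0 1 * enorm D &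
      w 0 1 = - (dot (T (w 0 0)) D / enorm D)].
Proof.
move=> z1 D; split=> [[zw _ zphi wphi]|[zw zphi wphi]].
  have D0 : 0 < enorm D := chord_gt0 zw.
  split; [exact: zw | |].
    rewrite zphi (cos_angle (dot_tangent table _) D0) opprK.
    by rewrite (divfK (lt0r_neq0 D0)).
  by rewrite wphi (cos_angle (dot_tangent table _) D0).
have D0 : 0 < enorm D := chord_gt0 zw.
have c1 : dot (T (z 0 0)) D / enorm D = - z 0 1.
  by rewrite zphi (mulfK (lt0r_neq0 D0)).
split; [exact: zw | | |].
- rewrite (angle_unit _ (dot_tangent table _)) c1; apply: acos_itv.
  by rewrite ltrNl opprK ltrNl andbC.
- by rewrite (cos_angle (dot_tangent table _) D0) c1 opprK.
- by rewrite (cos_angle (dot_tangent table _) D0).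
Qed.

(* The unit vector along the chord leaving z 0 0 is determined by its tangential
   component, and by strict convexity a ray from a boundary point meets the
   boundary only once more. *)
Lemma billiard_step_unique (z w w' : 'rV[R]_2) : -1 < z 0 1 < 1 ->
  billiard_step P gamma z w -> billiard_step P gamma z w' -> w = w'.
Proof.
move=> z1 /(billiard_stepP _ z1)[]; set x := z 0 0; set D := gamma _ - gamma _.
move=> zw Dw w1 /(billiard_stepP _ z1)[]; set D' := gamma _ - gamma _.
move=> zw' Dw' w1'.
have D0 : 0 < enorm D := chord_gt0 zw.
have D'0 : 0 < enorm D' := chord_gt0 zw'.
have strictD (v : R) : x < v < x + P -> 0 < dot (gamma v - gamma x) (N x).
  move=> xv; apply: (strict_support table evoluteK) => /same_ptC.
  exact: not_same_pt table _ _ xv.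
have normalD (v : R) (d := gamma v - gamma x) : x < v < x + P ->
    dot (T x) d = - z 0 1 * enorm d ->
    dot d (N x) ^+ 2 = enorm d ^+ 2 * (1 - z 0 1 ^+ 2).
  move=> xv dT; have := lagrange_identity d (T x).
  rewrite (dotC d (T x)) dT (dot_tangent table) -enorm_sqr mulr1.
  move: (enorm d) (dot d _) (z 0 1) => e n y h.
  by rewrite mulrBr mulr1 -{1}h; ring.
have colin : D' = (enorm D' / enorm D) *: D.
  have nE : dot D' (N x) = enorm D' / enorm D * dot D (N x).
    exact: colinear_normal D0 D'0 (strictD _ zw) (strictD _ zw')
      (normalD _ zw Dw) (normalD _ zw' Dw').
  rewrite {1}(dot_unit D' (dot_tangent table x)) {2}(dot_unit D (dot_tangent table x)).
  rewrite nE !(dotC _ (T x)) Dw Dw' scalerDr !scalerA; congr (_ *: _ + _).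
  by rewrite mulrCA (divfK (lt0r_neq0 D0)).
have [ww|ww] := eqVneq (w 0 0) (w' 0 0).
  by apply: rV2P; [exact: ww | rewrite w1 w1' /D' -ww].
have nsp : ~ same_pt P (w 0 0) (w' 0 0).
  case/andP: zw => zw1 zw2; case/andP: zw' => zw1' zw2'.
  case: (ltgtP (w 0 0) (w' 0 0)) ww => // ww _.
    by apply: (not_same_pt table); rewrite ww (lt_trans zw2')// ltrD2r.
  move=> /same_ptC; apply: (not_same_pt table).
  by rewrite ww (lt_trans zw2)// ltrD2r.
have xw v : x < v < x + P -> ~ same_pt P x v by move=> /(not_same_pt table).
have := strict_support table evoluteK (xw _ zw).
have := strict_support table evoluteK (xw _ zw').
have := strict_support table evoluteK nsp.
have := strict_support table evoluteK (fun h => nsp (same_ptC h)).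
have -> : gamma (w' 0 0) - gamma (w 0 0) = D' - D by rewrite /D /D' opprB addrA subrK.
have -> : gamma (w 0 0) - gamma (w' 0 0) = D - D' by rewrite /D /D' opprB addrA subrK.
have -> : gamma x - gamma (w 0 0) = - D by rewrite opprB.
have -> : gamma x - gamma (w' 0 0) = - D' by rewrite opprB.
have := divr_gt0 D'0 D0.
move: colin; move: (enorm D' / enorm D) => c -> c0.
rewrite (dotBl (c *: D) D) (dotBl D (c *: D)) (dotNl (c *: D)) (dotNl D).
rewrite !(dotZl c D) => cp cq q0 p0; case: (chord_order c0 cp cq q0 p0).
Qed.

End Billiard.

Section BilliardMap.
Context {R : realType} {P : R} {gamma : R -> 'rV[R]_2} {K : set 'rV[R]_2}.
Hypothesis table : bounds_convex_table P gamma K.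
Hypothesis evoluteK : evolute gamma `<=` K.

Local Notation T := (derive1 gamma).
Local Notation double_normal := (@double_normal R gamma).

Lemma phase_pt_0 (x y : R) : phase_pt x y 0 0 = x.
Proof. by rewrite mxE. Qed.

Lemma phase_pt_1 (x y : R) : phase_pt x y 0 1 = y.
Proof. by rewrite mxE. Qed.

Lemma billiard_mapE (z w : 'rV[R]_2) : -1 < z 0 1 < 1 ->
  billiard_step P gamma z w -> billiard_map P gamma z = w.
Proof.
move=> z1 zw; apply: (billiard_step_unique table evoluteK z1 _ zw).
by apply: (@getPex _ [set w | billiard_step P gamma z w]); exists w.
Qed.

(** Zeros of [Phi z] are the solutions of the reflection equation. At [z0] it decreases through 0 at
    [v], its derivative being -1; the signs at [v - d] and [v + d] survive for nearby [z], a zero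
    lies between, and uniqueness of the step identifies it with the chosen value. *)
Lemma billiard_map_near u v l (e : R) : double_normal u v l -> u < v < u + P ->
  0 < e -> \forall z \near phase_pt u 0,
    [/\ -1 < (z : 'rV[R]_2) 0 1 < 1, billiard_step P gamma z (billiard_map P gamma z) &
        `|v - billiard_map P gamma z 0 0| <= e].
Proof.
move=> [l0 uv Tvu] /andP[u_lt_v v_lt_uP] e0; set z0 := phase_pt u 0.
pose Phi (z : 'rV[R]_2) s := dot (T (z 0 0)) (gamma s - gamma (z 0 0)) +
  z 0 1 * enorm (gamma s - gamma (z 0 0)).
have Phi0 s : Phi z0 s = dot (T u) (gamma s - gamma u).
  by rewrite /Phi phase_pt_0 phase_pt_1 mul0r addr0.
have cx : (fun z : 'rV[R]_2 => z 0 0) @ z0 --> u.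
  by rewrite -[X in _ --> X](phase_pt_0 u 0); exact: coord_continuous.
have cy : (fun z : 'rV[R]_2 => z 0 1) @ z0 --> (0 : R).
  by rewrite -[X in _ --> X](phase_pt_1 u 0); exact: coord_continuous.
have cg : (fun z : 'rV[R]_2 => gamma (z 0 0)) @ z0 --> gamma u.
  exact: cvg_comp cx (cvg_gamma table u).
have cT : (fun z : 'rV[R]_2 => T (z 0 0)) @ z0 --> T u.
  exact: cvg_comp cx (cvg_tangent table u).
have cPhi s : Phi z s @[z --> z0] --> Phi z0 s.
  have cD : (fun z : 'rV[R]_2 => gamma s - gamma (z 0 0)) @ z0 -->
      gamma s - gamma u.
    exact: cvgB (cvg_cst _) cg.
  rewrite Phi0 -[X in _ --> X]addr0 -[X in _ --> _ + X](mul0r (enorm (gamma s - gamma u))).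
  exact: cvgD (cvg_dot cT cD) (cvgM cy (cvg_enorm cD)).
have cPhis z : continuous (Phi z).
  move=> s; have cD : gamma r - gamma (z 0 0) @[r --> s] --> gamma s - gamma (z 0 0).
    exact: cvgB (cvg_gamma table s) (cvg_cst _).
  exact: cvgD (cvg_dot (cvg_cst _) cD) (cvgM (cvg_cst _) (cvg_enorm cD)).
have [d d0 [de dv]] : exists2 d, 0 < d & d <= e /\ forall s, `|v - s| <= d ->
    [/\ u < s, s < u + P & s != v -> 0 < - Phi z0 s * (s - v)].
  have dPhi : is_derive v 1 (fun s => - Phi z0 s) 1.
    have dg : is_derive v 1 (fun s => gamma s - gamma u) (T v - 0).
      by apply: is_deriveB; exact: (is_derive_gamma table).
    have := is_deriveN (is_derive_dot (is_derive_cst (T u) v 1) dg).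
    rewrite dot0l add0r subr0 Tvu dotNr (dot_tangent table) opprK.
    by congr is_derive; apply/funext => s; rewrite /= Phi0.
  have n1 := is_derive_incr dPhi ltr01.
  have n2 : \forall s \near v, u < s by apply: lt_nbhsr.
  have n3 : \forall s \near v, s < u + P by apply: lt_nbhsl.
  have : \forall s \near v, [/\ u < s, s < u + P & s != v -> 0 < - Phi z0 s * (s - v)].
    near=> s; split; [by near: s| by near: s|].
    move=> sv; have : 0 < (- Phi z0 s - - Phi z0 v) * (s - v) by move: sv; near: s.
    by rewrite [Phi z0 v]Phi0 uv dotZr dot_rot90_self mulr0 oppr0 subr0.
  move=> /nbhs_ballP[d /= d0 dv]; exists (Num.min (d / 2) e).
    by rewrite lt_min divr_gt0.
  split; first by rewrite ge_min lexx orbT.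
  move=> s; rewrite le_min => /andP[sd _]; apply: dv; rewrite /ball/=.
  by rewrite (le_lt_trans sd)// ltr_pdivrMr// ltr_pMr// ltr1n.
pose sp := v + d; pose sm := v - d.
have spE : sp - v = d by rewrite /sp addrAC subrr add0r.
have smE : sm - v = - d by rewrite /sm addrAC subrr add0r.
have spd : `|v - sp| <= d by rewrite distrC spE gtr0_norm.
have smd : `|v - sm| <= d by rewrite distrC smE normrN gtr0_norm.
have spv : sp != v by rewrite gt_eqF// ltrDl.
have smv : sm != v by rewrite lt_eqF// ltrBlDr ltrDl.
have [up spP /(_ spv) Psp] := dv sp spd.
have [um smP /(_ smv) Psm] := dv sm smd.
have {}Psp : Phi z0 sp < 0 by move: Psp; rewrite spE pmulr_lgt0// oppr_gt0.
have {}Psm : 0 < Phi z0 sm by move: Psm; rewrite smE mulrNN pmulr_lgt0.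
have smp : sm <= sp by rewrite lerD2l ge0_cp// ltW.
near=> z.
have z1 : -1 < z 0 1 < 1.
  apply/andP; split; near: z.
    by move: cy => /cvgr_gt; apply; rewrite ltrN10.
  by move: cy => /cvgr_lt; apply.
have Pzp : Phi z sp < 0 by near: z; move: (cPhi sp) => /cvgr_lt; apply.
have Pzm : 0 < Phi z sm by near: z; move: (cPhi sm) => /cvgr_gt; apply.
have zm : z 0 0 < sm by near: z; move: cx => /cvgr_lt; apply.
have zp : sp - P < z 0 0 by near: z; move: cx => /cvgr_gt; apply; rewrite ltrBlDr.
have [|s] := IVT (v := 0) smp (continuous_subspaceT (cPhis z)).
  have Ppm := ltW (lt_trans Pzp Pzm).
  by rewrite min_r// max_l// (ltW Pzp) (ltW Pzm).
rewrite in_itv/= => /andP[ms sp'] Ps.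
set D := gamma s - gamma (z 0 0).
have zw : billiard_step P gamma z (phase_pt s (- (dot (T s) D / enorm D))).
  apply/(billiard_stepP table _ z1); rewrite phase_pt_0 phase_pt_1; split => //.
    by rewrite (lt_le_trans zm)//= (le_lt_trans sp')// -ltrBlDr.
  by rewrite mulNr; apply/eqP; rewrite -addr_eq0; apply/eqP.
rewrite (billiard_mapE z1 zw); split=> //.
by rewrite phase_pt_0 (le_trans _ de)// distrC ler_distl ms sp'.
Unshelve. all: by end_near. Qed.

End BilliardMap.

(** * The differential of the billiard map at a double normal *)

Section Differential.
Context {R : realType} {P : R} {gamma : R -> 'rV[R]_2} {K : set 'rV[R]_2}.
Hypothesis table : bounds_convex_table P gamma K.
Hypothesis evoluteK : evolute gamma `<=` K.

Local Notation T := (derive1 gamma).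
Local Notation N t := (rot90 (derive1 gamma t)).
Local Notation k := (curvature gamma).
Local Notation double_normal := (@double_normal R gamma).
Local Notation bmap := (billiard_map P gamma).

Definition mx2 (a b c d : R) : 'M[R]_2 :=
  \matrix_(i < 2, j < 2)
    if i == 0 then (if j == 0 then a else b) else (if j == 0 then c else d).

Lemma cvg_mx2 (S : Type) (F : set_system S) {FF : Filter F} (a b c d : S -> R)
    (a0 b0 c0 d0 : R) (i j : 'I_2) :
  a x @[x --> F] --> a0 -> b x @[x --> F] --> b0 ->
  c x @[x --> F] --> c0 -> d x @[x --> F] --> d0 ->
  mx2 (a x) (b x) (c x) (d x) i j @[x --> F] --> mx2 a0 b0 c0 d0 i j.
Proof.
move=> aa bb cc dd; rewrite mxE; under eq_fun do rewrite mxE.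
by case: (i == 0); case: (j == 0).
Qed.

Lemma mul_mx2 (u : 'rV[R]_2) a b c d :
  (u *m mx2 a b c d) 0 0 = u 0 0 * a + u 0 1 * c /\
  (u *m mx2 a b c d) 0 1 = u 0 0 * b + u 0 1 * d.
Proof. by rewrite !mulmx_rV2 !mxE. Qed.

Lemma mulmx2 a b c d a' b' c' d' : mx2 a b c d *m mx2 a' b' c' d' =
  mx2 (a * a' + b * c') (a * b' + b * d') (c * a' + d * c') (c * b' + d * d').
Proof.
apply/matrixP => i j; rewrite !mxE big_ord_recl big_ord1 !mxE/=.
by case: (i == 0); case: (j == 0).
Qed.

Lemma billiard_map_normal u v l : double_normal u v l -> u < v < u + P ->
  bmap (phase_pt u 0) = phase_pt v 0.
Proof.
move=> [l0 uv Tvu] uvP.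
have y1 : -1 < (phase_pt u (0 : R)) 0 1 < 1 by rewrite phase_pt_1 ltrN10 ltr01.
apply: (billiard_mapE table evoluteK y1); apply/(billiard_stepP table _ y1).
rewrite !phase_pt_0 !phase_pt_1 uv Tvu dotNl dotZr dot_rot90_self.
by rewrite mulr0 !oppr0 !mul0r oppr0; split.
Qed.

Lemma cvg_billiard_map u v l : double_normal u v l -> u < v < u + P ->
  (fun z => bmap z 0 0) @ (phase_pt u 0 : 'rV[R]_2) --> v.
Proof.
have FF : Filter (nbhs (phase_pt u 0 : 'rV[R]_2)) by exact: nbhs_filter.
move=> uvl uvP; apply/(@cvgrPdist_le _ _ _ _ FF) => e e0.
near=> z.
suff [] : [/\ -1 < (z : 'rV[R]_2) 0 1 < 1, billiard_step P gamma z (bmap z) &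
    `|v - bmap z 0 0| <= e] by [].
by near: z; exact: (billiard_map_near table evoluteK uvl uvP e0).
Unshelve. all: by end_near. Qed.

Lemma caratheodory_tau (t x y p q b e : R) :
  0 + (t * b - x * q) + x * p = - y * e -> t * b = x * (q - p) - y * e.
Proof. by move=> h; rewrite -mulNr -h; ring. Qed.

Lemma caratheodory_solve (t x y a b c d e w : R) : b != 0 -> e != 0 ->
  t * b = x * a - y * e -> w = - ((t * c - x * d) / e) ->
  t = x * (a / b) + y * (- e / b) /\
  w = x * ((a / b) * (- c / e) + d / e) + y * ((- e / b) * (- c / e)).
Proof.
move=> b0 e0 tb ->; have -> : t = (x * a - y * e) / b by rewrite -tb mulfK.
by split; field; rewrite ?b0 ?e0.
Qed.

(* Bounces satisfy <T x, D> = - y |D| and y' = - <T x', D> / |D| for the chord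
   D = gamma x' - gamma x. Replacing gamma and T by their difference quotients
   at u and v solves these equations exactly for (x', y') - (v, 0) as a linear
   function of (x, y) - (u, 0) with continuous coefficients, so that no implicit
   function theorem is needed. Vectors are rows, hence the transposed matrix. *)
Lemma billiard_differentiable u v l
    (A := l * k u - 1) (B := l * k v - 1) :
  double_normal u v l -> u < v < u + P ->
  differentiable bmap (phase_pt u 0) /\
  jacobian bmap (phase_pt u 0) = mx2 A ((A * B - 1) / l) l B.
Proof.
move=> uvl uvP; have [l0 uv Tvu] := uvl; set z0 : 'rV[R]_2 := phase_pt u 0.
pose tau (z : 'rV[R]_2) : R := bmap z 0 0.
pose D z : 'rV[R]_2 := gamma (tau z) - gamma (z 0 0).
pose e z := enorm (D z).
(* With [x], [y] the coordinates of [z], the bounce equation becomes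
   [(tau - v) * b = (x - u) * a - y * e], and the inner product giving the new angle is
   [(tau - v) * c - (x - u) * d]. The limits of [b], [a], [c], [d] are -1, [- A], [- B], -1, so
   division by [b] is safe nearby. *)
pose b z := dot (T u) (slope gamma v (tau z)).
pose a (z : 'rV[R]_2) := dot (T u) (slope gamma u (z 0 0)) - dot (slope T u (z 0 0)) (D z).
pose c z := dot (T v) (slope gamma v (tau z)) + dot (slope T v (tau z)) (D z).
pose d (z : 'rV[R]_2) := dot (T v) (slope gamma u (z 0 0)).
have cx : (fun z : 'rV[R]_2 => z 0 0) @ z0 --> u.
  by rewrite -[X in _ --> X](phase_pt_0 u 0); exact: coord_continuous.
have ct : tau @ z0 --> v := cvg_billiard_map uvl uvP.
have cD : D @ z0 --> l *: N u.
  have cgt : (fun z => gamma (tau z)) @ z0 --> gamma v.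
    exact: cvg_comp ct (cvg_gamma table v).
  have cgx : (fun z : 'rV[R]_2 => gamma (z 0 0)) @ z0 --> gamma u.
    exact: cvg_comp cx (cvg_gamma table u).
  by rewrite -uv; exact: cvgB cgt cgx.
have le : enorm (l *: N u) = l.
  by rewrite -uv; apply: (double_normal_enorm table uvl).
have ce : e @ z0 --> l by rewrite -[X in _ --> X]le; exact: cvg_enorm cD.
have csv : (fun z => slope gamma v (tau z)) @ z0 --> T v.
  exact: cvg_comp ct (cvg_slope (is_derive_gamma table v)).
have csu : (fun z : 'rV[R]_2 => slope gamma u (z 0 0)) @ z0 --> T u.
  exact: cvg_comp cx (cvg_slope (is_derive_gamma table u)).
have cTv : (fun z => slope T v (tau z)) @ z0 --> k v *: N v.
  exact: cvg_comp ct (cvg_slope (is_derive_tangent table v)).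
have cTu : (fun z : 'rV[R]_2 => slope T u (z 0 0)) @ z0 --> k u *: N u.
  exact: cvg_comp cx (cvg_slope (is_derive_tangent table u)).
have cb : b @ z0 --> (-1 : R).
  have -> : -1 = dot (T u) (T v) :> R by rewrite Tvu dotNr (dot_tangent table).
  exact: cvg_dot (cvg_cst _) csv.
have ca : a @ z0 --> - A.
  have -> : - A = dot (T u) (T u) - dot (k u *: N u) (l *: N u).
    rewrite dotZl dotZr (dot_normal table) (dot_tangent table) /A.
    by move: (k u) => ku; ring.
  exact: cvgB (cvg_dot (cvg_cst _) csu) (cvg_dot cTu cD).
have cc : c @ z0 --> - B.
  have -> : - B = dot (T v) (T v) + dot (k v *: N v) (l *: N u).
    rewrite dotZl dotZr Tvu rot90N dotNl dotNl dotNr opprK.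
    rewrite (dot_normal table) (dot_tangent table) /B.
    by move: (k v) => kv; ring.
  exact: cvgD (cvg_dot (cvg_cst _) csv) (cvg_dot cTv cD).
have cd : d @ z0 --> (-1 : R).
  have -> : -1 = dot (T v) (T u) :> R by rewrite Tvu dotNl (dot_tangent table).
  exact: cvg_dot (cvg_cst _) csu.
pose M z := mx2 (a z / b z) ((a z / b z) * (- c z / e z) + d z / e z)
  (- e z / b z) ((- e z / b z) * (- c z / e z)).
have l_neq0 : l != 0 by rewrite gt_eqF.
have N1_neq0 : (-1 : R) != 0 by rewrite oppr_eq0 oner_eq0.
have cab : (fun z => a z / b z) @ z0 --> - A / -1 by exact: cvgM ca (cvgV N1_neq0 cb).
have ceb : (fun z => - e z / b z) @ z0 --> - l / -1.
  by exact: cvgM (cvgN ce) (cvgV N1_neq0 cb).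
have cce : (fun z => - c z / e z) @ z0 --> - - B / l.
  by exact: cvgM (cvgN cc) (cvgV l_neq0 ce).
have cde : (fun z => d z / e z) @ z0 --> -1 / l by exact: cvgM cd (cvgV l_neq0 ce).
apply: (caratheodory_jacobian (M := M)); last first.
  move=> i j.
  have -> : mx2 A ((A * B - 1) / l) l B = mx2 (- A / -1)
      (- A / -1 * (- - B / l) + -1 / l) (- l / -1) (- l / -1 * (- - B / l)).
    by congr mx2; field.
  exact: cvg_mx2 cab (cvgD (cvgM cab cce) cde) ceb (cvgM ceb cce).
rewrite (billiard_map_normal uvl uvP).
near=> z.
have [z1 zw _] : [/\ -1 < (z : 'rV[R]_2) 0 1 < 1, billiard_step P gamma z (bmap z) &
    `|v - bmap z 0 0| <= 1].
  by near: z; exact: (billiard_map_near table evoluteK uvl uvP ltr01).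
have [ztau zD zw1] := (billiard_stepP table _ z1).1 zw.
have ez : e z != 0 by rewrite lt0r_neq0//; exact: (chord_gt0 table ztau).
have bz : b z != 0.
  by rewrite lt_eqF//; near: z; move: cb => /cvgr_lt; apply; rewrite ltrN10.
set x := z 0 0 in ztau zD; set y := z 0 1 in zD.
have DE : D z = l *: N u + ((tau z - v) *: slope gamma v (tau z) -
    (x - u) *: slope gamma u x).
  by rewrite /D (slopeE gamma v) (slopeE gamma u (z 0 0)) opprD addrACA uv.
have tb : (tau z - v) * b z = (x - u) * a z - y * e z.
  have : dot (T u) (D z) + (x - u) * dot (slope T u x) (D z) = - y * e z.
    by rewrite -dotZl -dotDl -(slopeE T u); exact: zD.
  rewrite {1}DE dotDr dotZr dot_rot90_self dotBr !dotZr -/x -/(b z) /a.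
  by rewrite mulr0; exact: caratheodory_tau.
have tc : dot (T (tau z)) (D z) = (tau z - v) * c z - (x - u) * d z.
  rewrite (slopeE T v (tau z)) dotDl dotZl {1}DE dotDr dotZr Tvu dotNl.
  rewrite dot_rot90_self dotBr !dotZr -Tvu /c -/x -/(d z).
  by rewrite oppr0 mulr0 add0r mulrDr addrAC.
have [w0 w1] : tau z - v = (x - u) * (a z / b z) + y * (- e z / b z) /\
    bmap z 0 1 = (x - u) * ((a z / b z) * (- c z / e z) + d z / e z) +
      y * ((- e z / b z) * (- c z / e z)).
  have : bmap z 0 1 = - (dot (T (tau z)) (D z) / e z) := zw1.
  by rewrite tc; exact: caratheodory_solve bz ez tb.
have [z00 z01] : (z - z0) 0 0 = x - u /\ (z - z0) 0 1 = y.
  by rewrite !mxE/= subr0.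
have [M00 M01] := mul_mx2 (z - z0) (a z / b z)
  ((a z / b z) * (- c z / e z) + d z / e z) (- e z / b z)
  ((- e z / b z) * (- c z / e z)).
apply: rV2P; rewrite mxE ?phase_pt_0 ?phase_pt_1.
  by rewrite M00 z00 z01 -w0 addrC subrK.
by rewrite M01 z00 z01 -w1 add0r.
Unshelve. all: by end_near. Qed.

End Differential.

(** * Composition of the two bounces and stability *)

Section Stability.
Context {R : realType} {P : R} {gamma : R -> 'rV[R]_2} {K : set 'rV[R]_2}.
Hypothesis table : bounds_convex_table P gamma K.
Hypothesis evoluteK : evolute gamma `<=` K.

Local Notation T := (derive1 gamma).
Local Notation k := (curvature gamma).
Local Notation double_normal := (@double_normal R gamma).
Local Notation bmap := (billiard_map P gamma).

Lemma curvature_periodz (t : R) (m : int) : k (t + m%:~R * P) = k t.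
Proof.
have T'E : derive1 T (t + m%:~R * P) = derive1 T t.
  by apply: derive1_periodic => s; exact: (tangent_periodz table).
by rewrite /curvature T'E (tangent_periodz table t m).
Qed.

(** Reduction by the floor gives a half-open window; distinctness modulo [P] makes its left end
    strict. *)
Lemma same_pt_window (u v : R) : ~ same_pt P u v ->
  exists m : int, u < v + m%:~R * P < u + P.
Proof.
move=> uv; have P0 := curve_period_gt0 (table_curve table).
exists (- Num.floor ((v - u) / P)).
have := floor_le ((v - u) / P); have := lt_succ_floor ((v - u) / P).
rewrite intrD mulrNz ltr_pdivrMr// ler_pdivlMr//.
set m : R := (Num.floor _)%:~R => m1 m0.
have mu : v - m * P != u.
  apply: contra_notN uv => /eqP vE; exists (- Num.floor ((v - u) / P)).
  by rewrite -/m mulrNz -{1}vE -/m; ring.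
rewrite lt_def mulNr mu/=; lra.
Qed.

Lemma trace_det_T2 (l A B : R) (C := (A * B - 1) / l) (C' := (B * A - 1) / l) :
  l != 0 -> 0 <= A -> 0 <= B -> A * B <= 1 ->
  (A * B + C * l) * (l * C' + B * A) - (A * C' + C * A) * (l * B + B * l) = 1 /\
  ((A * B + C * l) + (l * C' + B * A)) ^+ 2 <= 4.
Proof.
move=> l0 A0 B0 AB1; split; first by rewrite /C /C'; field.
have -> : (A * B + C * l) + (l * C' + B * A) = 4 * (A * B) - 2.
  by rewrite /C /C'; field.
have := mulr_ge0 A0 B0; move: (A * B) AB1 => p p1 p0; nra.
Qed.

(** Here [(l * p - 1) * (l * q - 1) - 1 = l * (l * (p * q) - p - q)]. *)
Lemma trace_bound (l p q : R) : 0 < l -> l * (p * q) <= p + q ->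
  (l * p - 1) * (l * q - 1) <= 1.
Proof. by move=> l0; rewrite -(ler_pM2l l0) => pq; nra. Qed.

Lemma double_normal_stable (u v l : R) : double_normal u v l ->
  u < v < u + P -> l * (k u * k v) <= k u + k v ->
  differentiable (bmap \o bmap) (phase_pt u 0) /\
  forall lambda : R[i],
    eigenvalue
      (map_mx (real_complex R) (jacobian (bmap \o bmap) (phase_pt u 0))) lambda ->
    `|lambda| <= 1.
Proof.
move=> uvl uvP kl; have [l0 _ _] := uvl.
(* The lift always advances, so the return bounce ends at [u + P]. It is the same chord reversed,
   which exchanges [A] and [B] in the second Jacobian. *)
have vul : double_normal v (u + P) l.
  have := double_normal_shift table 0 1 (double_normal_sym uvl).
  by rewrite !mul0r addr0 mul1r.
have vuP : v < u + P < v + P by case/andP: uvP => uv ->; rewrite ltrD2r.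
have [d1 J1] := billiard_differentiable table evoluteK uvl uvP.
have [d2 J2] := billiard_differentiable table evoluteK vul vuP.
have kuP : k (u + P) = k u by have := curvature_periodz u 1; rewrite mul1r.
have uv := billiard_map_normal table evoluteK uvl uvP.
rewrite kuP -uv in J2; rewrite -uv in d2.
split; first exact: differentiable_comp.
have A0 := double_normal_curvature table evoluteK uvl.
have B0 := double_normal_curvature table evoluteK (double_normal_sym uvl).
rewrite (jacobian_comp d1 d2) J1 J2 mulmx2.
rewrite -subr_ge0 in A0; rewrite -subr_ge0 in B0.
have AB : (l * k u - 1) * (l * k v - 1) <= 1.
  exact: trace_bound l0 kl.
have [det tr] := trace_det_T2 (lt0r_neq0 l0) A0 B0 AB.
apply: stable_mx2.
  by rewrite !mxE/=; exact: det.
by rewrite !mxE/=; exact: tr.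
Qed.

End Stability.

Theorem proposition2p27 (R : realType) (P : R) (gamma : R -> 'rV[R]_2)
    (K : set 'rV[R]_2) (a b : R) (x : 'rV[R]_3) :
  bounds_convex_table P gamma K ->
  evolute gamma `<=` K ->
  minimizer P gamma (triple a b a) ->
  mountain_pass_trajectory P gamma a b x ->
  linearly_stable P gamma x.
Proof.
move=> table evoluteK _ pass; have [xcrit _] := pass.
have kl := mountain_pass_curvature table evoluteK pass.
have uvl := critical_double_normal table xcrit.
have [m uvP] : exists m : int, x 0 0 < x 0 1 + m%:~R * P < x 0 0 + P.
  by apply: (same_pt_window table); case: xcrit => -[].
rewrite /linearly_stable.
have -> : - cos (angle (derive1 gamma (x 0 0)) (gamma (x 0 1) - gamma (x 0 0))) = 0.
  have [l0 uv _] := uvl.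
  rewrite (cos_angle (dot_tangent table _) l0) uv dotZr dot_rot90_self.
  by rewrite mulr0 mul0r oppr0.
(* Changing the lift of the second bounce puts it in the window of [billiard_map]; chord and
   curvatures are unchanged. *)
have uvl' := double_normal_shift table 0 m uvl.
rewrite mul0r addr0 in uvl'.
apply: (double_normal_stable table evoluteK uvl' uvP).
by rewrite (curvature_periodz table).
Qed.
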